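(* Let $f:\mathbb{R}\to\mathbb{R}$ be a homeomorphism such that the map $$\mathcal{E}_{NS}(f)(x+iy)=\frac{f(x+y)+f(x-y)}{2}+i\,\frac{f(x+y)-f(x-y)}{2},\qquad x\in\mathbb{R},\ y>0,$$ belongs to $QC(\mathbb{H})$. Then $f$ is bi-Lipschitz, i.e. there is $c\ge1$ such that $c^{-1}|x-y|\le|f(x)-f(y)|\le c|x-y|$ for all $x,y\in\mathbb{R}$.
   Context: $\mathbb{H}=\{z=x+iy:x\in\mathbb{R},\ y>0\}$. $QC(\mathbb{H})$ is the set of quasiconformal automorphisms of $\mathbb{H}$: homeomorphisms $F:\mathbb{H}\to\mathbb{H}$ (onto) with $F\in W^{1,2}_{loc}(\mathbb{H})$ for which there is $k<1$ such that $|\partial_{\bar z}F(z)|\le k\,|\partial_zF(z)|$ for almost every $z\in\mathbb{H}$. *)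

(* Defs.v *)
(* MathComp-Analysis.  The complex plane is identified with R * R, the point
   x + iy being the pair (x, y). *)
From HB Require Import structures.
From mathcomp Require Import all_boot all_order all_algebra.
From mathcomp Require Import complex.
From mathcomp Require Import all_classical all_reals all_analysis.
Set Implicit Arguments.
Unset Strict Implicit.
Unset Printing Implicit Defensive.
Import Order.TTheory GRing.Theory Num.Theory.
Import numFieldNormedType.Exports.
Local Open Scope classical_set_scope.
Local Open Scope ring_scope.
Local Open Scope complex_scope.

Definition homeomorphism_between (T U : topologicalType) (A : set T) (B : set U)
    (f : T -> U) : Prop :=
  exists g : U -> T,
    [/\ set_fun A B f, {in A, cancel f g} & {within A, continuous f}] /\
    [/\ set_fun B A g, {in B, cancel g f} & {within B, continuous g}].

Section Plane.
Variable R : realType.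

Definition plane_measure :
    {measure set (measurableTypeR R * measurableTypeR R) -> \bar R} :=
  (@lebesgue_measure R \x @lebesgue_measure R)%E.

Definition upper_half_plane : set (R * R) := [set p | 0 < p.2].

Definition cplx (p : R * R) : R[i] := p.1 +i* p.2.

Definition e_x : R * R := (1, 0).
Definition e_y : R * R := (0, 1).

Fixpoint Cn (n : nat) (phi : R * R -> R) : Prop :=
  continuous phi /\
  match n with
  | 0%N => True
  | m.+1 => (forall p, derivable phi p e_x /\ derivable phi p e_y) /\
            Cn m ('D_e_x phi) /\ Cn m ('D_e_y phi)
  end.

Definition test_function (Om : set (R * R)) (phi : R * R -> R) : Prop :=
  [/\ forall n, Cn n phi,
      compact (closure [set p | phi p != 0]) &
      closure [set p | phi p != 0] `<=` Om].

Definition L2loc (Om : set (R * R)) (u : R * R -> R) : Prop :=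
  measurable_fun Om u /\
  forall K : set (R * R), compact K -> K `<=` Om ->
    (\int[plane_measure]_(p in K) (`|u p| ^+ 2)%:E < +oo)%E.

(* Meaningful for locally integrable [u] and [g]: [Rintegral] is total. *)
Definition weak_derivative (Om : set (R * R)) (v : R * R) (u g : R * R -> R) :
    Prop :=
  forall phi, test_function Om phi ->
    \int[plane_measure]_(p in Om) (u p * 'D_v phi p) =
    - \int[plane_measure]_(p in Om) (g p * phi p).

(* [u] is in W^{1,2}_loc(Om), with weak partial derivatives [ux] and [uy]. *)
Definition W12loc (Om : set (R * R)) (u ux uy : R * R -> R) : Prop :=
  [/\ L2loc Om u, L2loc Om ux, L2loc Om uy,
      weak_derivative Om e_x u ux & weak_derivative Om e_y u uy].

(* The same for a map into the plane, componentwise. *)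
Definition W12loc_map (Om : set (R * R)) (F Fx Fy : R * R -> R * R) : Prop :=
  W12loc Om (fst \o F) (fst \o Fx) (fst \o Fy) /\
  W12loc Om (snd \o F) (snd \o Fx) (snd \o Fy).

(* The Wirtinger derivatives computed from the partial derivatives
   [a = F_x] and [b = F_y] at a point. *)
Definition d_z (a b : R * R) : R[i] := (cplx a - 'i * cplx b) / 2.
Definition d_zbar (a b : R * R) : R[i] := (cplx a + 'i * cplx b) / 2.

(* [QC F]: the restriction of [F] to the upper half-plane is a quasiconformal
   automorphism of it; values of [F] elsewhere are irrelevant.  Weak partial
   derivatives are unique up to null sets, hence the choice of [Fx], [Fy] does
   not matter.  The inequality compares moduli as elements of [R[i]]. *)
Definition QC (F : R * R -> R * R) : Prop :=
  homeomorphism_between upper_half_plane upper_half_plane F /\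
  exists Fx Fy : R * R -> R * R,
    W12loc_map upper_half_plane F Fx Fy /\
    exists2 k : R, k < 1 &
      {ae plane_measure, forall p, upper_half_plane p ->
         `|d_zbar (Fx p) (Fy p)| <= k%:C * `|d_z (Fx p) (Fy p)|}.

Definition E_NS (f : R -> R) (p : R * R) : R * R :=
  ((f (p.1 + p.2) + f (p.1 - p.2)) / 2, (f (p.1 + p.2) - f (p.1 - p.2)) / 2).

Definition bi_lipschitz (f : R -> R) : Prop :=
  exists2 c : R, 1 <= c &
    forall x y, c^-1 * `|x - y| <= `|f x - f y| <= c * `|x - y|.

End Plane.

(* Main.v *)
(* Put s = x + y and t = x - y.  In these coordinates E_NS f is the product map
   (s, t) |-> (f s, f t) up to a linear change of the target, so its weak
   derivatives are combinations of f'(s) and f'(t), with d_z = (f'(s) + f'(t))/2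
   and d_zbar = i (f'(s) - f'(t))/2.  Since f is increasing, the dilatation
   bound says that f'(s) and f'(t) are comparable for almost all s > t, with a
   uniform constant K.  Integrated over boxes ]a, b] x ]c, d] with d < a, this
   compares the difference quotients of f over any two disjoint intervals, and a
   third interval far to the right compares any two intervals, with constant K^2.

   The derivative f' is never constructed.  Testing the weak derivatives against
   products of smooth plateaus in s and t, then letting the plateaus tend to
   indicators, computes their integrals over every box; a Dynkin argument,
   against the product of the Lebesgue and Lebesgue-Stieltjes measures, turns
   these values into pointwise almost everywhere information. *)
From HB Require Import structures.
Require Import Defs.
From mathcomp Require Import all_boot all_order all_algebra.
From mathcomp Require Import complex.
From mathcomp Require Import all_classical all_reals all_analysis.
From mathcomp Require Import measurable_realfun ring lra.
Set Implicit Arguments.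
Unset Strict Implicit.
Unset Printing Implicit Defensive.
Import Order.TTheory GRing.Theory Num.Theory.
Import numFieldNormedType.Exports.
Local Open Scope classical_set_scope.
Local Open Scope ring_scope.

(** * Smooth functions of one variable *)

Section Smooth.
Variable R : realType.
Implicit Types (g h : R -> R) (n : nat).

(** Class C^n. The derivative is an existential witness, so that closure proofs can exhibit it in
    closed form. *)
Fixpoint smooth n g : Prop :=
  match n with
  | 0%N => continuous g
  | m.+1 => exists2 g', (forall x : R, is_derive x 1 g (g' x)) & smooth m g'
  end.

Lemma is_derive_continuous g (g' : R -> R) :
  (forall x : R, is_derive x 1 g (g' x)) -> continuous g.
Proof.
move=> dg x; apply: differentiable_continuous.
by apply/derivable1_diffP; case: (dg x).
Qed.

Lemma smooth_continuous n g : smooth n g -> continuous g.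
Proof. by case: n => //= n [g' /is_derive_continuous]. Qed.

Lemma smoothW n g : smooth n.+1 g -> smooth n g.
Proof.
elim: n g => [|n IH] g; first exact: smooth_continuous.
by case=> g' dg /IH g's; exists g'.
Qed.

Lemma smooth_cst n (c : R) : smooth n (fun=> c).
Proof.
elim: n c => [|n IH] c /=; first by move=> x; exact: cvg_cst.
exists (fun=> 0); [by move=> x; exact: is_derive_cst|exact: IH].
Qed.

Lemma smoothD n g h : smooth n g -> smooth n h -> smooth n (fun x => g x + h x).
Proof.
elim: n g h => [|n IH] g h /=.
  by move=> cg ch x; apply: cvgD; [exact: cg|exact: ch].
move=> [g' dg sg] [h' dh sh]; exists (fun x => g' x + h' x); last exact: IH.
by move=> x; exact: is_deriveD.
Qed.

Lemma smoothM n g h : smooth n g -> smooth n h -> smooth n (fun x => g x * h x).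
Proof.
elim: n g h => [|n IH] g h.
  by move=> cg ch x; apply: cvgM; [exact: cg|exact: ch].
move=> sg' sh'; move: (sg') (sh') => [g' dg sg] [h' dh sh].
exists (fun x => g x * h' x + h x * g' x).
  by move=> x; exact: is_deriveM.
by apply: smoothD; apply: IH => //; exact: smoothW.
Qed.

Lemma smoothV n g : (forall x, g x != 0) -> smooth n g ->
  smooth n (fun x => (g x)^-1).
Proof.
move=> g0; elim: n => [|n IH].
  by move=> cg x; apply: cvgV => //; exact: cg.
move=> sg'; move: (sg') => [g' dg sg].
(* The quotient rule, written as a product so that [smoothM] applies, with [IH] for each copy of the
   inverse. *)
exists (fun x => (- 1) * (g x)^-1 * (g x)^-1 * g' x).
  move=> x; have := is_deriveV (g0 x) (dg x) => /is_derive_eq; apply.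
  by rewrite /GRing.scale/= expr2 invfM; ring.
have sV := IH (smoothW sg').
by do !apply: smoothM => //; exact: smooth_cst.
Qed.

Lemma smooth_affine n g (c d : R) : smooth n g ->
  smooth n (fun x => g (c * x + d)).
Proof.
elim: n g => [|n IH] g /=.
  move=> cg x; apply: (@continuous_comp _ _ _ (fun x => c * x + d) g).
    by apply: cvgD; [apply: cvgM; [exact: cvg_cst|exact: cvg_id]|exact: cvg_cst].
  exact: cg.
move=> [g' dg sg]; exists (fun x => g' (c * x + d) * c).
  move=> x; rewrite -[c in _ * c]/(c).
  have dl : is_derive x (1:R) (fun y : R => c * y + d) c.
    by apply: is_derive_eq; rewrite /GRing.scale/= ; ring.
  exact: (@is_derive1_comp _ g (fun y : R => c * y + d)).
by apply: smoothM; [exact: IH|exact: smooth_cst].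
Qed.


(** For [m = 0], the classical flat function exp(-1/x). The negative powers of x are included so
    that derivatives are linear combinations of members of the same family. *)
Definition flat_exp (m : nat) (x : R) : R :=
  if 0 < x then x ^- m * expR (- x^-1) else 0.

Lemma flat_exp_ge0 m x : 0 <= flat_exp m x.
Proof.
rewrite /flat_exp; case: ifP => // x0.
by rewrite mulr_ge0 ?expR_ge0// invr_ge0 exprn_ge0// ltW.
Qed.

Lemma flat_exp_gt0 m x : 0 < x -> 0 < flat_exp m x.
Proof. by move=> x0; rewrite /flat_exp x0 mulr_gt0 ?expR_gt0// invr_gt0 exprn_gt0. Qed.

Lemma flat_exp_le0 m x : x <= 0 -> flat_exp m x = 0.
Proof. by move=> x0; rewrite /flat_exp ltNge x0. Qed.

(* [expR t >= t ^+ N / N`!] at [t = 1 / x]. *)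
Lemma flat_exp_le m x : flat_exp m x <= (m.+2)`!%:R * x ^+ 2.
Proof.
rewrite /flat_exp; case: ifP => x0; last by rewrite mulr_ge0 ?sqr_ge0.
set N := (m.+2)`!%:R; have N0 : 0 < N :> R by rewrite ltr0n fact_gt0.
have le1 : (x^-1) ^+ m.+2 / N <= expR x^-1.
  apply: le_trans (expR_ge1Dxn m.+1 _); last by rewrite invr_ge0 ltW.
  by rewrite lerDr.
rewrite expRN ler_pdivrMr ?expR_gt0//.
apply: (@le_trans _ _ (N * x ^+ 2 * ((x^-1) ^+ m.+2 / N))).
  rewrite exprVn; rewrite le_eqVlt; apply/orP; left; apply/eqP.
  have -> : x ^+ m.+2 = x ^+ m * x ^+ 2 by rewrite -exprD addn2.
  by field; rewrite ?expf_neq0 ?gt_eqF//.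
by rewrite ler_wpM2l// mulr_ge0 ?sqr_ge0// ltW.
Qed.

(** The difference quotient at 0 has modulus at most C |h|. *)
Lemma is_derive0_quadratic (C : R) g : (forall y, `|g y| <= C * y ^+ 2) ->
  is_derive (0 : R) (1 : R) g 0.
Proof.
move=> gC.
have g0 : g 0 = 0.
  by apply/normr0_eq0/le_anti; rewrite normr_ge0 (le_trans (gC 0))// expr0n/= mulr0.
have E : (fun h : R => h^-1 *: ((g \o shift 0) (h *: (1 : R)) - g 0)) =
    (fun h : R => h^-1 * g h).
  by apply/funext => h; rewrite /= g0 subr0 addr0 /GRing.scale/= mulr1.
have cC : (C * `|h| : R) @[h --> (0 : R)^'] --> (0 : R).
  have : (C * `|h| : R) @[h --> (0 : R)^'] --> (C * `|0 : R|).
    apply: cvgM; first exact: cvg_cst.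
    by apply: cvg_norm; exact: nbhs_dnbhs.
  by rewrite normr0 mulr0.
have nb : \forall h \near (0 : R)^', - (C * `|h|) <= h^-1 * g h <= C * `|h|.
  near=> h; have h0 : h != 0 by near: h; exact: nbhs_dnbhs_neq.
  rewrite -ler_norml normrM normfV.
  rewrite ler_pdivrMl ?normr_gt0// mulrCA -normrM -expr2.
  by rewrite (ger0_norm (sqr_ge0 h)); exact: gC.
have cv : (h^-1 * g h : R) @[h --> (0 : R)^'] --> (0 : R).
  have cN : (- (C * `|h|) : R) @[h --> (0 : R)^'] --> (0 : R).
    by rewrite -[X in _ --> X]oppr0; exact: cvgN.
  exact: (squeeze_cvgr nb cN cC).
rewrite -E in cv.
apply: DeriveDef; first by apply/cvg_ex; exists 0.
exact/cvg_lim.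
Unshelve. all: by end_near. Qed.

Lemma is_derive_flat_exp m x :
  is_derive x (1 : R) (flat_exp m) (flat_exp m.+2 x - m%:R * flat_exp m.+1 x).
Proof.
have [x0|x0|->] := ltgtP x 0.
- rewrite !flat_exp_le0 ?ltW// mulr0 subr0.
  apply: (@near_eq_is_derive _ _ _ (fun=> 0)).
    near=> y; rewrite flat_exp_le0//; near: y.
    by apply: filterS (lt_nbhsl x0) => y /ltW.
- apply: (@near_eq_is_derive _ _ _ (fun y : R => y ^- m * expR (- y^-1))).
    near=> y; rewrite /flat_exp ifT//; near: y.
    exact: lt_nbhsr.
  have xn0 : x != 0 by rewrite gt_eqF.
  have d1 := is_deriveV xn0 (is_derive_id x (1 : R)).
  have d2 : is_derive x (1 : R) (fun y : R => expR (- y^-1))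
      (expR (- x^-1) * x ^- 2).
    have d3 : is_derive x (1 : R) (fun y : R => - y^-1) (x ^- 2).
      have := is_deriveN d1 => /is_derive_eq; apply.
      by rewrite /GRing.scale/= mulr1 opprK.
    exact: (@is_derive1_comp _ expR (fun y : R => - y^-1)).
  have d4 : is_derive x (1 : R) (fun y : R => y ^- m)
      (m%:R * (x^-1) ^+ m.-1 * - x ^- 2).
    have := is_deriveX m d1 => /is_derive_eq.
    rewrite (_ : (fun y => y^-1) ^+ m = fun y : R => y ^- m); last first.
      by apply/funext => y; rewrite fctE exprVn.
    by apply; rewrite /GRing.scale/= mulr1.
  have := is_deriveM d4 d2 => /is_derive_eq; apply.
  (* The case [m = 0] is separate because the power rule carries the truncated exponent [m.-1]. *)
  rewrite /GRing.scale/= /flat_exp x0; case: (m) => [|k] /=.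
    by rewrite !expr0 invr1; field.
  have -> : x ^- k.+3 = x ^- k.+1 * x ^- 2 by rewrite -invfM -exprD addn2.
  have -> : x ^- k.+2 = x ^- k * x ^- 2 by rewrite -invfM -exprD addn2.
  by rewrite exprVn; ring.
(* At the gluing point 0, the quadratic bound [flat_exp_le] forces the derivative 0. *)
rewrite !flat_exp_le0// mulr0 subr0; apply: (@is_derive0_quadratic (m.+2)`!%:R).
by move=> y; rewrite ger0_norm ?flat_exp_ge0// flat_exp_le.
Unshelve. all: by end_near. Qed.

(** The induction on [n] must hold for all [m] at once, since differentiating raises [m]. *)
Lemma smooth_flat_exp n m : smooth n (flat_exp m).
Proof.
have dm k := is_derive_flat_exp k.
elim: n m => [|n IH] m; first exact: is_derive_continuous (dm m).
exists (fun x => flat_exp m.+2 x - m%:R * flat_exp m.+1 x) => //.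
rewrite (_ : (fun x => _) =
  fun x => flat_exp m.+2 x + (- m%:R) * flat_exp m.+1 x); last first.
  by apply/funext => x; rewrite mulNr.
by apply: smoothD => //; apply: smoothM => //; exact: smooth_cst.
Qed.

Lemma smooth_derive1 n g : smooth n.+1 g -> smooth n (derive1 g).
Proof.
move=> [g' dg sg]; rewrite (_ : (derive1 g) = g')//.
by apply/funext => x; rewrite derive1E; exact: derive_val.
Qed.

Lemma smooth_is_derive n g (x : R) : smooth n.+1 g -> is_derive x 1 g ((derive1 g) x).
Proof.
by move=> [g' dg sg]; rewrite derive1E; apply: DeriveDef => //; exact: ex_derive.
Qed.

Lemma flat_exp0_nondecreasing : {homo flat_exp 0 : x y / x <= y}.
Proof.
move=> x y; rewrite le_eqVlt => /predU1P[->//|xy].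
have dm (z : R) : is_derive z 1 (flat_exp 0) (flat_exp 2 z).
  by apply: is_derive_eq (is_derive_flat_exp 0 z) _; rewrite mul0r subr0.
have [|c _] := MVT xy (fun z _ => dm z).
  by apply: continuous_subspaceT; exact: is_derive_continuous dm.
by move=> E; rewrite -subr_ge0 E mulr_ge0 ?flat_exp_ge0// subr_ge0 ltW.
Qed.

(** The usual smooth transition from 0 to 1 on [0, 1]. The denominator never vanishes, since [x] or
    [1 - x] is positive. *)
Definition smooth_step (x : R) : R :=
  flat_exp 0 x / (flat_exp 0 x + flat_exp 0 (1 - x)).

Let denom_gt0 x : 0 < flat_exp 0 x + flat_exp 0 (1 - x).
Proof.
have [x0|x0] := ltP 0 x.
  by rewrite ltr_wpDr ?flat_exp_ge0// flat_exp_gt0.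
by rewrite ltr_wpDl ?flat_exp_ge0// flat_exp_gt0//; lra.
Qed.

Lemma smooth_smooth_step n : smooth n smooth_step.
Proof.
apply: smoothM; first exact: smooth_flat_exp.
apply: smoothV => [x|]; first by rewrite gt_eqF.
apply: smoothD; first exact: smooth_flat_exp.
rewrite (_ : (fun x => _) = fun x => flat_exp 0 (- 1 * x + 1)).
  exact/smooth_affine/smooth_flat_exp.
by apply/funext => x; congr flat_exp; ring.
Qed.

Lemma smooth_step_le0 x : x <= 0 -> smooth_step x = 0.
Proof. by move=> x0; rewrite /smooth_step flat_exp_le0// mul0r. Qed.

Lemma smooth_step_ge1 x : 1 <= x -> smooth_step x = 1.
Proof.
move=> x1; rewrite /smooth_step [flat_exp 0 (1 - x)]flat_exp_le0 ?subr_le0//.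
by rewrite addr0 divff// gt_eqF// flat_exp_gt0//; lra.
Qed.

Lemma smooth_step_ge0 x : 0 <= smooth_step x.
Proof. by rewrite divr_ge0 ?flat_exp_ge0// ltW. Qed.

Lemma smooth_step_le1 x : smooth_step x <= 1.
Proof. by rewrite ler_pdivrMr// mul1r lerDl flat_exp_ge0. Qed.

(** With e for [flat_exp 0], cross-multiplying and cancelling the common term leaves e(x) e(1 - y)
    <= e(y) e(1 - x), which follows from the monotonicity of e. *)
Lemma smooth_step_nondecreasing : {homo smooth_step : x y / x <= y}.
Proof.
move=> x y xy; rewrite /smooth_step ler_pdivrMr// mulrAC ler_pdivlMr//.
rewrite !mulrDr [X in X + _ <= _]mulrC lerD2l ler_pM ?flat_exp_ge0//.
  exact: flat_exp0_nondecreasing.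
by apply: flat_exp0_nondecreasing; lra.
Qed.

Lemma derive_smooth_step_ge0 x : 0 <= derive1 smooth_step x.
Proof.
rewrite derive1E; apply: limr_ge.
  by have [] := smooth_is_derive x (smooth_smooth_step 1).
near=> h; rewrite /GRing.scale/= mulr1.
have : h != 0 by near: h; exact: nbhs_dnbhs_neq.
rewrite neq_lt => /orP[h0|h0].
  have hi : h^-1 <= 0 by rewrite invr_le0 ltW.
  by rewrite mulr_le0// subr_le0 smooth_step_nondecreasing// gerDr ltW.
have hi : 0 <= h^-1 by rewrite invr_ge0 ltW.
by rewrite mulr_ge0// subr_ge0 smooth_step_nondecreasing// lerDr ltW.
Unshelve. all: by end_near. Qed.

Lemma derive_smooth_step_out x : x < 0 \/ 1 < x -> derive1 smooth_step x = 0.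
Proof.
move=> H; rewrite derive1E.
have dc (c : R) : (\forall y \near x, c = smooth_step y) ->
    is_derive x (1 : R) smooth_step 0.
  by move=> nc; exact: (near_eq_is_derive nc (is_derive_cst c x 1)).
case: H => H.
  have [|//] := dc 0; near=> y; rewrite smooth_step_le0//; near: y.
  by apply: filterS (lt_nbhsl H) => y /ltW.
have [|//] := dc 1; near=> y; rewrite smooth_step_ge1//; near: y.
by apply: filterS (lt_nbhsr H) => y /ltW.
Unshelve. all: by end_near. Qed.

End Smooth.

(** * Test functions with separated variables *)

Section Separated.
Variable R : realType.
Implicit Types (eta theta : R -> R) (p : R * R).

(** A product in the coordinates s = x + y and t = x - y, in which [E_NS f] separates. *)
Definition sep eta theta p : R := eta (p.1 + p.2) * theta (p.1 - p.2).

Lemma continuous_sep eta theta :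
  continuous eta -> continuous theta -> continuous (sep eta theta).
Proof.
move=> ce ct p; apply: cvgM.
  apply: (@continuous_comp _ _ _ (fun p : R * R => p.1 + p.2) eta).
    by apply: cvgD; [exact: cvg_fst|exact: cvg_snd].
  exact: ce.
apply: (@continuous_comp _ _ _ (fun p : R * R => p.1 - p.2) theta).
  by apply: cvgB; [exact: cvg_fst|exact: cvg_snd].
exact: ct.
Qed.

(** The directional difference quotient is the one-variable quotient along the line through [p], so
    the one-variable rules become available. *)
Lemma is_derive_line (phi : R * R -> R) p v (d : R) :
  is_derive (0 : R) (1 : R) (fun h : R => phi (h *: v + p)) d ->
  is_derive p v phi d.
Proof.
move=> [dphi Dphi].
have E : (fun h : R => h^-1 *: ((phi \o shift p) (h *: v) - phi p)) =
    (fun h : R => h^-1 *: (((fun h : R => phi (h *: v + p)) \o shift 0)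
        (h *: (1 : R)) - phi ((0 : R) *: v + p))).
  by apply/funext => h; rewrite /= addr0 [h *: 1]mulr1 scale0r add0r.
by split; rewrite /derivable /derive E.
Qed.

Lemma is_derive_sep eta theta (e' t' : R -> R) p (v : R * R) :
  (forall x : R, is_derive x 1 eta (e' x)) ->
  (forall x : R, is_derive x 1 theta (t' x)) ->
  is_derive p v (sep eta theta)
    (sep e' theta p * (v.1 + v.2) + sep eta t' p * (v.1 - v.2)).
Proof.
move=> de dt; apply: is_derive_line.
have dl (c d : R) : is_derive (0 : R) (1 : R) (fun h : R => h * c + d) c.
  by apply: is_derive_eq; rewrite /GRing.scale/=; ring.
pose u (h : R) := h * (v.1 + v.2) + (p.1 + p.2).
pose w (h : R) := h * (v.1 - v.2) + (p.1 - p.2).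
rewrite (_ : (fun h : R => _) = fun h => eta (u h) * theta (w h)); last first.
  by apply/funext => h; rewrite /sep /u /w /= /GRing.scale/=; congr (eta _ * theta _); ring.
have d1 : is_derive (0 : R) (1 : R) (fun h => eta (u h)) (e' (u 0) * (v.1 + v.2)).
  exact: (@is_derive1_comp _ eta u).
have d2 : is_derive (0 : R) (1 : R) (fun h => theta (w h)) (t' (w 0) * (v.1 - v.2)).
  exact: (@is_derive1_comp _ theta w).
have := is_deriveM d1 d2 => /is_derive_eq; apply.
by rewrite /sep /u /w /GRing.scale/= !mul0r !add0r; ring.
Qed.

Lemma CnD n (phi psi : R * R -> R) : Cn n phi -> Cn n psi ->
  Cn n (fun p => phi p + psi p).
Proof.
elim: n phi psi => [|n IH] phi psi [cphi] Hphi [cpsi] Hpsi.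
  by split => // p; apply: cvgD; [exact: cphi|exact: cpsi].
split; first by move=> p; apply: cvgD; [exact: cphi|exact: cpsi].
case: Hphi Hpsi => [dphi [xphi yphi]] [dpsi [xpsi ypsi]].
split=> [p|].
  have [? ?] := dphi p; have [? ?] := dpsi p.
  by split; exact: derivableD.
split; [move: (IH _ _ xphi xpsi)|move: (IH _ _ yphi ypsi)]; congr (Cn n _);
  apply/funext => p; have [? ?] := dphi p; have [? ?] := dpsi p;
  by rewrite -deriveD.
Qed.

Lemma CnN n (phi : R * R -> R) : Cn n phi -> Cn n (fun p => - phi p).
Proof.
elim: n phi => [|n IH] phi [cphi] Hphi.
  by split => // p; apply: cvgN; exact: cphi.
split; first by move=> p; apply: cvgN; exact: cphi.
case: Hphi => [dphi [xphi yphi]].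
split=> [p|].
  have [? ?] := dphi p.
  by split; exact: derivableN.
split; [move: (IH _ xphi)|move: (IH _ yphi)]; congr (Cn n _);
  apply/funext => p; have [? ?] := dphi p; by rewrite -deriveN.
Qed.

(** Each partial derivative is a sum or difference of two separated functions. In each of them one
    factor stays undifferentiated, hence [smoothW]. *)
Lemma Cn_sep n eta theta : smooth n eta -> smooth n theta -> Cn n (sep eta theta).
Proof.
elim: n eta theta => [|n IH] eta theta.
  by move=> ce ct; split => //; exact: continuous_sep.
move=> se st; split.
  by apply: continuous_sep; [exact: smooth_continuous se|exact: smooth_continuous st].
move: (se) (st) => [e' de se'] [t' dt st'].
have H p v := is_derive_sep p v de dt.
split.
  by move=> p; split; [have [] := H p (e_x R)|have [] := H p (e_y R)].
have C1 : Cn n (sep e' theta) by apply: IH => //; exact: smoothW.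
have C2 : Cn n (sep eta t') by apply: IH => //; exact: smoothW.
split.
  move: (CnD C1 C2); congr (Cn n _); apply/funext => p.
  have [_ ->] := H p (e_x R).
  by rewrite /= addr0 subr0 !mulr1.
move: (CnD C1 (CnN C2)); congr (Cn n _); apply/funext => p.
have [_ ->] := H p (e_y R).
by rewrite /= add0r sub0r mulr1 mulrN1.
Qed.

(** A closed box in (s, t), seen in the (x, y)-plane; it will contain the supports of the test
    functions. *)
Definition diamond (a b c d : R) : set (R * R) :=
  [set p | (a <= p.1 + p.2 <= b) && (c <= p.1 - p.2 <= d)].

Lemma diamondE a b c d : diamond a b c d =
  (fun q : R * R => ((q.1 + q.2) / 2, (q.1 - q.2) / 2)) @` (`[a, b] `*` `[c, d]).
Proof.
apply/seteqP; split => [[x y] /= /andP[H1 H2]|_ [[s t] /= [H1 H2] <-]].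
  exists (x + y, x - y); first by rewrite /= !in_itv.
  by congr (_, _); rewrite /=; field.
rewrite /diamond /= (_ : _ + _ = s); last by field.
by rewrite (_ : _ - _ = t); [apply/andP; rewrite !in_itv/= in H1 H2|field].
Qed.

Lemma compact_diamond a b c d : compact (diamond a b c d).
Proof.
rewrite diamondE; apply: continuous_compact.
  apply: continuous_subspaceT => q.
  have c1 : {for q, continuous (fun q : R * R => (q.1 + q.2) / 2)}.
    apply: cvgM; last exact: cvg_cst.
    by apply: cvgD; [exact: cvg_fst|exact: cvg_snd].
  have c2 : {for q, continuous (fun q : R * R => (q.1 - q.2) / 2)}.
    apply: cvgM; last exact: cvg_cst.
    by apply: cvgB; [exact: cvg_fst|exact: cvg_snd].
  exact: cvg_pair c1 c2.
by apply: compact_setX; exact: segment_compact.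
Qed.

Lemma closed_diamond a b c d : closed (diamond a b c d).
Proof. by apply: compact_closed; [exact: norm_hausdorff|exact: compact_diamond]. Qed.

(** Here y = (s - t) / 2 is at least (a - d) / 2. The condition [d < a] keeps this role in
    everything that follows. *)
Lemma diamond_upper a b c d : d < a -> diamond a b c d `<=` @upper_half_plane R.
Proof. move=> da [x y]; rewrite /diamond /upper_half_plane /=; lra. Qed.

Lemma test_function_sep eta theta a b c d : d < a ->
  (forall n, smooth n eta) -> (forall n, smooth n theta) ->
  (forall x, ~~ (a <= x <= b) -> eta x = 0) ->
  (forall x, ~~ (c <= x <= d) -> theta x = 0) ->
  test_function (@upper_half_plane R) (sep eta theta).
Proof.
move=> da se st e0 t0.
have sub : closure [set p | sep eta theta p != 0] `<=` diamond a b c d.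
  (* The diamond is closed, so it suffices that it contains the points where the product is
     non-zero. *)
  rewrite [X in _ `<=` X](iffLR (closure_id _) (@closed_diamond a b c d)).
  apply: closureS => p /=; rewrite /sep mulf_eq0 negb_or => /andP[H1 H2].
  by rewrite /diamond /=; apply/andP; split; [move: H1|move: H2];
    apply: contraNT => H; [rewrite e0|rewrite t0].
split.
- by move=> n; exact: Cn_sep.
- apply: subclosed_compact sub; first exact: closed_closure.
  exact: compact_diamond.
- exact: subset_trans sub (diamond_upper da).
Qed.

End Separated.

(** * Change of variables *)

(** The push-forward of [m], packaged with its measure structure so that uniqueness theorems for
    measures apply to it. *)
Definition image_measure d d' (T1 : measurableType d) (T2 : measurableType d')
    (R : realType) (m : {measure set T1 -> \bar R}) (f : T1 -> T2)
    (mf : measurable_fun setT f) : {measure set T2 -> \bar R} :=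
  measure_function_pushforward__canonical__measure_function_Measure m mf.

Section ChangeOfVariables.
Variable R : realType.
Local Notation mu := (@lebesgue_measure R).
Local Notation RB := (measurableTypeR R).

Lemma measurable_affine (c d : R) :
  measurable_fun [set: RB] ((fun x : R => c * x + d) : RB -> RB).
Proof. by apply: measurable_funD => //; exact: measurable_funM. Qed.

(** The right-hand side is a measure in [A] that agrees with Lebesgue measure on half-open
    intervals; uniqueness does the rest. *)
Lemma lebesgue_measure_affine (c d : R) (A : set RB) : 0 < c -> measurable A ->
  mu A = (c%:E * mu ((fun x : RB => (c * x + d : RB)%R) @^-1` A))%E.
Proof.
move=> c0 mA; have c0' := ltW c0.
transitivity (mscale (NngNum c0')
    (image_measure mu (measurable_affine c d)) A); last by [].
apply: lebesgue_measure_unique => // _ [[a b]] _ <- /=; rewrite /mscale /= /pushforward.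
rewrite (_ : _ @^-1` _ = `](a - d) / c, (b - d) / c]%classic); last first.
  apply/seteqP; split => x /=; rewrite !in_itv/= ltr_pdivrMr// ler_pdivlMr//; lra.
rewrite !lebesgue_measure_itv/= !lte_fin ltr_pM2r ?invr_gt0// ltrD2r.
case: ifPn => _; last by rewrite mule0.
rewrite -!EFinD -EFinM; congr EFin; field; exact: lt0r_neq0.
Qed.

Lemma ge0_integral_affine (c d : R) (F : RB -> \bar R) : 0 < c ->
  measurable_fun setT F -> (forall x, 0 <= F x)%E ->
  (\int[mu]_x F x = c%:E * \int[mu]_x F (c * x + d)%R)%E.
Proof.
move=> c0 mF F0; have c0' := ltW c0.
pose mf := measurable_affine c d.
transitivity (c%:E * \int[image_measure mu mf]_x F x)%E; last first.
  by rewrite (@ge0_integral_pushforward _ _ _ _ _ _ mf mu setT F).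
rewrite -(@ge0_integral_mscale _ _ _ _ _ measurableT (NngNum c0'))//.
apply: eq_measure_integral => A mA _; exact: lebesgue_measure_affine.
Qed.

Definition rot (p : RB * RB) : RB * RB := (p.1 + p.2, p.1 - p.2).

Lemma measurable_rot : measurable_fun setT rot.
Proof.
apply/measurable_fun_pairP; split => /=.
- by apply: measurable_funD.
- by apply: measurable_funB.
Qed.

(** Tonelli reduces the Jacobian 2 of [rot] to two affine substitutions on the line. *)
Lemma plane_measure_rot_setX (A B : set RB) : measurable A -> measurable B ->
  (2%:E * @plane_measure R (rot @^-1` (A `*` B)) = mu A * mu B)%E.
Proof.
move=> mA mB.
have mS : measurable (rot @^-1` (A `*` B)).
  rewrite -[X in measurable X]setTI.
  by apply: measurable_rot => //; exact: measurableX.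
have indicE x y : (\1_(rot @^-1` (A `*` B)) (x, y) : R) =
    \1_A (x + y) * \1_B (x - y).
  rewrite !indicE -natrM mulnb; congr (nat_of_bool _)%:R.
  apply/idP/andP => [/set_mem[? ?]|[/set_mem ? /set_mem ?]].
    by split; exact/mem_set.
  exact/mem_set.
have mH (c1 c2 d1 d2 : R) : measurable_fun [set: RB * RB]
    (fun z => (\1_A (c1 * z.1 + c2 * z.2) * \1_B (d1 * z.1 + d2 * z.2) : R)%:E).
  apply/measurable_EFinP; apply: measurable_funM.
    apply: (measurableT_comp (measurable_indic mA)).
    by apply: measurable_funD; apply: measurable_funM.
  apply: (measurableT_comp (measurable_indic mB)).
  by apply: measurable_funD; apply: measurable_funM.
have -> : @plane_measure R (rot @^-1` (A `*` B)) =
    (\int[@plane_measure R]_z (\1_(rot @^-1` (A `*` B)) z)%:E)%E.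
  by rewrite integral_indic// setIT.
rewrite [X in (_ * X)%E](@fubini_tonelli2 _ _ _ _ _ mu mu); last 2 first.
- exact/measurable_EFinP/measurable_indic.
- by move=> z; rewrite lee_fin.
rewrite /fubini_G.
pose H (c1 c2 d1 d2 : R) (z : RB * RB) :=
  (\1_A (c1 * z.1 + c2 * z.2) * \1_B (d1 * z.1 + d2 * z.2) : R)%:E.
have H0 c1 c2 d1 d2 z : (0 <= H c1 c2 d1 d2 z)%E by rewrite lee_fin mulr_ge0.
(* At fixed y, substitute t = x - y, so that x + y becomes t + 2y. *)
transitivity (2%:E * \int[mu]_y \int[mu]_t H 1%R 2%R 1%R 0%R (t, y))%E.
  congr (_ * _)%E; apply: eq_integral => y _.
  rewrite [RHS](@ge0_integral_affine 1 (- y))//; last first.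
    by apply: (measurableT_comp (mH 1 2 1 0)); exact: measurable_pair2.
  rewrite mul1e; apply: eq_integral => x _; rewrite indicE /H; congr EFin.
  by congr (\1_A _ * \1_B _); rewrite /=; ring.
rewrite -(@fubini_tonelli _ _ _ _ _ mu mu (H 1 2 1 0))//; last exact: mH.
rewrite -ge0_integralZl//; last 2 first.
- by apply: measurable_fun_fubini_tonelli_F => //; exact: mH.
- by move=> t _; exact: integral_ge0.
transitivity (\int[mu]_t (mu A * (\1_B t)%:E))%E.
  apply: eq_integral => t _.
  (* After exchanging the integrals, substitute s = t + 2y at fixed t; this absorbs the factor 2. *)
  transitivity (\int[mu]_s (\1_B t * \1_A s)%:E)%E.
    rewrite [RHS](@ge0_integral_affine 2 t)//; last first.
      by apply/measurable_EFinP; apply: measurable_funM => //; exact: measurable_indic.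
    congr (_ * _)%E; apply: eq_integral => s _; rewrite /H mulrC.
    by congr (EFin (\1_B _ * \1_A _)); rewrite /=; ring.
  under eq_integral do rewrite EFinM.
  rewrite ge0_integralZl//; last exact/measurable_EFinP/measurable_indic.
  by rewrite integral_indic// setIT muleC.
rewrite ge0_integralZl//; last exact/measurable_EFinP/measurable_indic.
by rewrite integral_indic// setIT.
Qed.

(** Twice the image of plane measure under [rot] agrees with plane measure on products of measurable
    sets, and a product measure is determined by these. *)
Lemma plane_measure_rot (X : set (RB * RB)) : measurable X ->
  (@plane_measure R X = 2%:E * @plane_measure R (rot @^-1` X))%E.
Proof.
move=> mX; have h2 : 0 <= 2 :> R by [].
transitivity (mscale (NngNum h2) (image_measure (@plane_measure R) measurable_rot) X); last by [].
by apply: product_measure_unique => // A B mA mB; exact: plane_measure_rot_setX.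
Qed.

End ChangeOfVariables.

(** * Integrals of separated functions over the plane *)

Section Integrals.
Variable R : realType.
Local Notation mu := (@lebesgue_measure R).
Local Notation RB := (measurableTypeR R).
Local Notation P := (@plane_measure R).

Lemma ge0_integral_rot (G : RB * RB -> \bar R) :
  measurable_fun setT G -> (forall z, 0 <= G z)%E ->
  (\int[P]_z G z = 2%:E * \int[P]_z G (rot z))%E.
Proof.
move=> mG G0; have h2 : 0 <= 2 :> R by [].
transitivity (2%:E * \int[image_measure P (@measurable_rot R)]_z G z)%E; last first.
  by rewrite (@ge0_integral_pushforward _ _ _ _ _ _ (@measurable_rot R) P setT G).
rewrite -(@ge0_integral_mscale _ _ _ _ _ measurableT (NngNum h2))//.
apply: eq_measure_integral => A mA _; exact: plane_measure_rot.
Qed.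

Lemma integrable_rot (G : RB * RB -> \bar R) : P.-integrable setT G ->
  P.-integrable setT (G \o @rot R).
Proof.
move=> /integrableP[mG Goo].
have mrot := @measurable_rot R.
apply/integrableP; split; first exact: measurableT_comp.
rewrite ge0_integral_rot in Goo => //; last exact: measurableT_comp.
(* Were the integral of the composition infinite, its double, the integral of the modulus of [G],
   would be too. *)
rewrite ltNge leye_eq; apply/negP => /eqP E; move: Goo.
by rewrite /= in E *; rewrite E mulry gtr0_sg// mul1e ltxx.
Qed.

Lemma integral_rot (G : RB * RB -> \bar R) : P.-integrable setT G ->
  (\int[P]_z G z = 2%:E * \int[P]_z G (rot z))%E.
Proof.
move=> iG; have mG := measurable_int P iG.
rewrite [LHS]integralE [X in (_ * X)%E]integralE muleBr//; last first.
  apply: fin_num_adde_defl; rewrite fin_numN.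
  by apply: integrable_neg_fin_num => //; exact: integrable_rot.
rewrite (ge0_integral_rot (measurable_funepos mG))//.
rewrite (ge0_integral_rot (measurable_funeneg mG))//.
congr (_ * _ - _ * _)%E; apply: eq_integral => z _.
  by rewrite !funeposE.
by rewrite !funenegE.
Qed.

Lemma integrable_prod (F G : RB -> R) :
  mu.-integrable setT (EFin \o F) -> mu.-integrable setT (EFin \o G) ->
  P.-integrable setT (fun z => (F z.1 * G z.2)%:E).
Proof.
move=> iF iG.
have mF : measurable_fun setT F.
  by apply/measurable_EFinP; exact: measurable_int iF.
have mG : measurable_fun setT G.
  by apply/measurable_EFinP; exact: measurable_int iG.
have mFG : measurable_fun [set: RB * RB] (fun z => (F z.1 * G z.2)%:E).
  apply/measurable_EFinP; apply: measurable_funM.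
    exact: (measurableT_comp mF measurable_fst).
  exact: (measurableT_comp mG measurable_snd).
apply/integrable12ltyP => //=.
pose I := (\int[mu]_y `|G y|%:E)%E.
have I0 : (0 <= I)%E by apply: integral_ge0 => y _; rewrite lee_fin.
have Ifin : I \is a fin_num.
  by rewrite ge0_fin_numE//; case/integrableP : iG.
have mN (H : RB -> R) : measurable_fun setT H ->
    measurable_fun setT (fun x => `|H x|%:E).
  by move=> mH; apply/measurable_EFinP; exact: measurableT_comp.
rewrite (eq_integral (fun x => `|F x|%:E * I)%E); last first.
  move=> x _; rewrite -ge0_integralZl//; last exact: mN.
  by apply: eq_integral => y _; rewrite /= normrM EFinM.
rewrite ge0_integralZr//; last exact: mN.
by rewrite muleC lte_mul_pinfty//; case/integrableP : iF.
Qed.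

Lemma integral_prod (F G : RB -> R) :
  mu.-integrable setT (EFin \o F) -> mu.-integrable setT (EFin \o G) ->
  \int[P]_z (F z.1 * G z.2) = (\int[mu]_x F x) * (\int[mu]_y G y).
Proof.
move=> iF iG; rewrite [LHS]/Rintegral.
rewrite -(integral12_prod_meas1 (integrable_prod iF iG)) /fubini_F /=.
set c := \int[mu]_y G y.
have Ec : (\int[mu]_y (G y)%:E = c%:E)%E.
  by rewrite fineK//; exact: integrable_fin_num.
transitivity (fine (\int[mu]_x ((F x)%:E * c%:E))%E).
  congr fine; apply: eq_integral => x _; under eq_integral do rewrite EFinM.
  by rewrite integralZl// Ec.
by rewrite integralZr// fineM//; exact: integrable_fin_num.
Qed.

Lemma integrable_sep (F G : R -> R) :
  mu.-integrable setT (EFin \o F) -> mu.-integrable setT (EFin \o G) ->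
  P.-integrable setT (EFin \o sep F G).
Proof. by move=> iF iG; exact: (integrable_rot (integrable_prod iF iG)). Qed.

(** Fubini in (s, t); the factor 1/2 is the inverse Jacobian of [rot]. *)
Lemma integral_sep (F G : R -> R) :
  mu.-integrable setT (EFin \o F) -> mu.-integrable setT (EFin \o G) ->
  \int[P]_z sep F G z = (\int[mu]_x F x) * (\int[mu]_y G y) / 2.
Proof.
move=> iF iG; rewrite -integral_prod// /Rintegral.
rewrite (integral_rot (integrable_prod iF iG)) fineM//; last first.
  by apply: integrable_fin_num => //; exact: integrable_sep.
by rewrite [RHS]mulrC mulKf.
Qed.

End Integrals.

(** * Smooth plateaus *)

Section Plateau.
Variable R : realType.
Local Notation mu := (@lebesgue_measure R).
Local Notation RB := (measurableTypeR R).
Implicit Types (k a b c x : R) (f F : R -> R).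

Lemma integrable_itv_supp F a b : continuous F ->
  (forall x, ~~ (a <= x <= b) -> F x = 0) -> mu.-integrable setT (EFin \o F).
Proof.
move=> cF F0.
have -> : EFin \o F = (EFin \o F) \_ `[a, b].
  apply/funext => x; rewrite patchE; case: ifPn => // xab /=; rewrite F0//.
  by apply: contraNN xab => xab; rewrite inE/= in_itv.
rewrite -integrable_mkcond//; apply: continuous_compact_integrable.
  exact: segment_compact.
exact: continuous_subspaceT.
Qed.

(** The transition placed on the ramp [a, a + 1/k]. The argument is kept in the form [c * x + d]
    expected by [smooth_affine]. *)
Definition step k a x := smooth_step (k * x + - (k * a)).
Definition dstep k a x := derive1 (@smooth_step R) (k * x + - (k * a)) * k.

Lemma smooth_step_affine n k a : smooth n (step k a).
Proof. exact/smooth_affine/smooth_smooth_step. Qed.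

Lemma smooth_dstep n k a : smooth n (dstep k a).
Proof.
apply: smoothM; last exact: smooth_cst.
by apply: smooth_affine; apply: smooth_derive1; exact: smooth_smooth_step.
Qed.

Lemma is_derive_step k a x : is_derive x 1 (step k a) (dstep k a x).
Proof.
have dl : is_derive x (1 : R) (fun y : R => k * y + - (k * a)) k.
  by apply: is_derive_eq; rewrite /GRing.scale/=; ring.
apply: (@is_derive1_comp _ _ (fun y : R => k * y + - (k * a))).
exact: smooth_is_derive (smooth_smooth_step R 1).
Qed.

Lemma step_ge0 k a x : 0 <= step k a x.
Proof. exact: smooth_step_ge0. Qed.

Lemma step_le1 k a x : step k a x <= 1.
Proof. exact: smooth_step_le1. Qed.

Lemma step_le0 k a x : 0 < k -> x <= a -> step k a x = 0.
Proof. by move=> k0 xa; rewrite /step smooth_step_le0// -mulrBr pmulr_rle0// subr_le0. Qed.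

Lemma step_ge1 k a x : 0 < k -> a + k^-1 <= x -> step k a x = 1.
Proof.
move=> k0 xa; rewrite /step smooth_step_ge1// -mulrBr -(mulfV (lt0r_neq0 k0)).
by rewrite ler_pM2l//; lra.
Qed.

Lemma dstep_ge0 k a x : 0 <= k -> 0 <= dstep k a x.
Proof. by move=> k0; rewrite mulr_ge0// derive_smooth_step_ge0. Qed.

Lemma dstep_out k a x : 0 < k -> ~~ (a <= x <= a + k^-1) -> dstep k a x = 0.
Proof.
move=> k0; rewrite negb_and -!ltNge => H.
rewrite /dstep derive_smooth_step_out ?mul0r// -mulrBr.
case/orP: H => H; [left|right]; first by rewrite pmulr_rlt0// subr_lt0.
by rewrite -(mulfV (lt0r_neq0 k0)) ltr_pM2l//; lra.
Qed.

Lemma integrable_dstepM k a f : 0 < k -> continuous f ->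
  mu.-integrable setT (EFin \o (fun x => f x * dstep k a x)).
Proof.
move=> k0 cf; apply: (@integrable_itv_supp _ a (a + k^-1)).
  move=> x; apply: cvgM; first exact: cf.
  exact: (smooth_continuous (smooth_dstep 0 k a)).
by move=> x /dstep_out ->//; rewrite mulr0.
Qed.

Lemma integrable_dstep k a : 0 < k -> mu.-integrable setT (EFin \o dstep k a).
Proof.
move=> k0; apply: (@integrable_itv_supp _ a (a + k^-1)).
  exact: (smooth_continuous (smooth_dstep 0 k a)).
by move=> x; exact: dstep_out.
Qed.

Lemma integral_dstep k a : 0 < k -> \int[mu]_x dstep k a x = 1.
Proof.
move=> k0; have k0' : 0 < k^-1 by rewrite invr_gt0.
rewrite (_ : dstep k a = dstep k a \_ `[a, a + k^-1]); last first.
  apply/funext => x; rewrite patchE; case: ifPn => // xab; rewrite dstep_out//.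
  by apply: contraNN xab => xab; rewrite inE/= in_itv.
rewrite -Rintegral_mkcond /Rintegral.
have aa : a < a + k^-1 by rewrite ltrDl.
rewrite (@continuous_FTC2 _ _ (step k a))//.
- by rewrite step_ge1// step_le0// /= subr0.
- by apply: continuous_subspaceT; exact: (smooth_continuous (smooth_dstep 0 k a)).
- split.
  + by move=> x _; case: (is_derive_step k a x).
  + apply: cvg_at_right_filter.
    exact: (smooth_continuous (smooth_step_affine 0 k a)).
  + apply: cvg_at_left_filter.
    exact: (smooth_continuous (smooth_step_affine 0 k a)).
- by move=> x _; rewrite derive1E; case: (is_derive_step k a x).
Qed.

(** [dstep k a] is a probability density supported on the ramp, so the integral is an average of [f]
    over [a, a + 1/k]. *)
Lemma integral_dstepM_bounds k a f : 0 < k -> continuous f ->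
  {homo f : x y / x <= y} ->
  f a <= \int[mu]_x (f x * dstep k a x) <= f (a + k^-1).
Proof.
move=> k0 cf ndf.
have id c : mu.-integrable setT (EFin \o (fun x => c * dstep k a x)).
  by apply: integrable_dstepM => // x; exact: cvg_cst.
have i1 := integrable_dstep a k0.
have Ed c : \int[mu]_x (c * dstep k a x) = c.
  by rewrite RintegralZl// integral_dstep// mulr1.
rewrite -[X in X <= _ <= _](Ed (f a)) -[X in _ <= _ <= X](Ed (f (a + k^-1))).
have d0 := fun x => dstep_ge0 a x (ltW k0).
apply/andP; split; apply: le_Rintegral => //; try exact: integrable_dstepM.
  move=> x _; have [/andP[ax _]|/dstep_out ->//] := boolP (a <= x <= a + k^-1).
    by rewrite ler_wpM2r// ndf.
  by rewrite !mulr0.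
move=> x _; have [/andP[_ ax]|/dstep_out ->//] := boolP (a <= x <= a + k^-1).
  by rewrite ler_wpM2r// ndf.
by rewrite !mulr0.
Qed.

(* A smooth approximation of the indicator of ]a, b], with ramps of length 1/k
   to the right of a and of b. *)
Definition plateau k a b x := step k a x - step k b x.
Definition dplateau k a b x := dstep k a x - dstep k b x.

Lemma smooth_plateau n k a b : smooth n (plateau k a b).
Proof.
rewrite (_ : plateau k a b = fun x => step k a x + (- 1) * step k b x); last first.
  by apply/funext => x; rewrite mulN1r.
apply: smoothD; first exact: smooth_step_affine.
by apply: smoothM; [exact: smooth_cst|exact: smooth_step_affine].
Qed.

Lemma is_derive_plateau k a b x : is_derive x 1 (plateau k a b) (dplateau k a b x).
Proof. by apply: is_deriveB; exact: is_derive_step. Qed.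

Lemma continuous_dplateau k a b : continuous (dplateau k a b).
Proof.
by move=> x; apply: cvgB; exact: (smooth_continuous (smooth_dstep 0 k _)).
Qed.

Lemma plateau_norm_le1 k a b x : `|plateau k a b x| <= 1.
Proof.
rewrite ler_norml /plateau.
have := step_ge0 k a x; have := step_le1 k a x.
by have := step_ge0 k b x; have := step_le1 k b x; lra.
Qed.

Lemma plateau_out k a b x : 0 < k -> a <= b -> ~~ (a <= x <= b + k^-1) ->
  plateau k a b x = 0.
Proof.
move=> k0 ab; have k0' : 0 < k^-1 by rewrite invr_gt0.
rewrite negb_and -!ltNge /plateau => /orP[H|H].
  by rewrite !step_le0 ?subrr//; lra.
by rewrite !step_ge1 ?subrr//; lra.
Qed.

Lemma dplateau_out k a b x : 0 < k -> a <= b -> ~~ (a <= x <= b + k^-1) ->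
  dplateau k a b x = 0.
Proof.
move=> k0 ab H.
by rewrite /dplateau !dstep_out ?subrr//; apply: contraNN H => /andP[? ?]; lra.
Qed.

Lemma integral_dplateau k a b : 0 < k -> \int[mu]_x dplateau k a b x = 0.
Proof.
move=> k0; have i1 c := integrable_dstep c k0.
have -> : \int[mu]_x dplateau k a b x = \int[mu]_x dstep k a x - \int[mu]_x dstep k b x.
  exact: (RintegralB measurableT (i1 a) (i1 b)).
by rewrite (integral_dstep a k0) (integral_dstep b k0) subrr.
Qed.

(** The middle term is the average of [f] over the ramp at [b] minus that over the ramp at [a]; it
    stands for the integral of f' against the plateau. *)
Lemma integral_dplateauM_bounds k a b f : 0 < k -> continuous f ->
  {homo f : x y / x <= y} ->
  f b - f (a + k^-1) <= - (\int[mu]_x (f x * dplateau k a b x))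
    <= f (b + k^-1) - f a.
Proof.
move=> k0 cf ndf.
pose I c := \int[mu]_x (f x * dstep k c x).
have IE : \int[mu]_x (f x * dplateau k a b x) = I a - I b.
  rewrite -(RintegralB measurableT (integrable_dstepM a k0 cf)
    (integrable_dstepM b k0 cf)).
  by apply: eq_Rintegral => x _; exact: mulrBr.
have Ib c : f c <= I c <= f (c + k^-1) by exact: integral_dstepM_bounds.
rewrite {}IE; clearbody I.
have /andP[a1 a2] := Ib a; have /andP[b1 b2] := Ib b.
by rewrite opprB; apply/andP; split; apply: lerB.
Qed.

(** Since the ramps start at [a] and [b] and run to the right, each step vanishes at its own
    starting point. The limit is therefore the indicator of an interval open on the left and closed
    on the right. *)
Lemma plateau_cvg a b x (k_ : nat -> R) : (forall n, 0 < k_ n) ->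
  (k_ n)^-1 @[n --> \oo] --> 0 -> a <= b ->
  plateau (k_ n) a b x @[n --> \oo] --> (\1_(`]a, b]) x : R).
Proof.
move=> k0 kcvg ab.
have step_cvg c : step (k_ n) c x @[n --> \oo] --> ((c < x)%R%:R : R).
  have [cx|xc] := ltP c x; last first.
    by under eq_fun do rewrite step_le0//; exact: cvg_cst.
  apply: cvg_near_cst; near=> n; apply/eqP; rewrite step_ge1//.
  have : (k_ n)^-1 < x - c; last by lra.
  by near: n; apply: (cvgr_lt 0 kcvg); rewrite subr_gt0.
rewrite (_ : \1_ _ _ = (a < x)%R%:R - (b < x)%R%:R); first exact: cvgB.
rewrite indicE mem_setE in_itv/= [x <= b]leNgt.
have [ax|xa] := ltP a x; have [bx|xb] := ltP b x => //=; rewrite ?subrr ?subr0//.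
by lra.
Unshelve. all: by end_near. Qed.

End Plateau.

(** * Letting the plateaus tend to indicators *)

Section Limits.
Variable R : realType.
Local Notation mu := (@lebesgue_measure R).
Local Notation RB := (measurableTypeR R).
Local Notation P := (@plane_measure R).
Local Notation H := (@upper_half_plane R).
Implicit Types a b c d e : R.

Lemma Rintegral_dominated_cvg disp (T : measurableType disp)
    (m : {measure set T -> \bar R}) (D : set T) (F : nat -> T -> R)
    (f g : T -> R) : measurable D ->
  (forall n, measurable_fun D (F n)) ->
  (forall x, D x -> F n x @[n --> \oo] --> f x) ->
  m.-integrable D (EFin \o g) ->
  (forall n x, D x -> `|F n x| <= g x) ->
  \int[m]_(x in D) F n x @[n --> \oo] --> \int[m]_(x in D) f x.
Proof.
move=> mD mF Ff ig Fg.
have mf : measurable_fun D f by exact: measurable_fun_cvg Ff.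
have [] := @dominated_convergence _ _ _ m D mD (fun n => EFin \o F n) (EFin \o f)
  (EFin \o g) _ _ _ ig _.
- by move=> n; exact/measurable_EFinP.
- exact/measurable_EFinP.
- by apply/aeW => x Dx; apply: cvg_EFin; [exact: nearW|exact: Ff].
- by apply/aeW => x n Dx; rewrite lee_fin; exact: Fg.
move=> iF _ cv; apply: fine_cvg.
by rewrite fineK//; exact: integrable_fin_num.
Qed.

Lemma integral_plateau_cvg a b e (k_ : nat -> R) : (forall n, 0 < k_ n) ->
  (k_ n)^-1 @[n --> \oo] --> 0 -> (forall n, (k_ n)^-1 <= e) -> a <= b ->
  \int[mu]_x plateau (k_ n) a b x @[n --> \oo] --> b - a.
Proof.
move=> k0 kcvg ke ab.
have -> : b - a = \int[mu]_x (\1_(`]a, b]) x : R).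
  rewrite /Rintegral integral_indic// setIT /= lebesgue_measure_itv/= lte_fin.
  case: ltP => //= ba; have -> : b = a by apply/le_anti; rewrite ba.
  by rewrite subrr.
(* As [e] bounds all ramp lengths, every plateau is dominated by the indicator of [a, b + e]. *)
apply: (@Rintegral_dominated_cvg _ _ mu setT _ _ (\1_(`[a, b + e]))) => //.
- move=> n; apply: continuous_measurable_fun.
  exact: smooth_continuous (smooth_plateau 0 _ _ _).
- by move=> x _; exact: plateau_cvg.
- by apply: integrable_indic_itv.
move=> n x _; rewrite indicE mem_setE in_itv/=.
have [_|abx] := boolP (a <= x <= b + e); first exact: plateau_norm_le1.
rewrite plateau_out ?normr0//; apply: contraNN abx => /andP[ax xb].
by rewrite ax (le_trans xb)// lerD2l.
Qed.

Lemma integral_dplateauM_cvg a b (k_ : nat -> R) (f : R -> R) :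
  (forall n, 0 < k_ n) -> (k_ n)^-1 @[n --> \oo] --> 0 ->
  continuous f -> {homo f : x y / x <= y} ->
  - (\int[mu]_x (f x * dplateau (k_ n) a b x)) @[n --> \oo] --> f b - f a.
Proof.
move=> k0 kcvg cf ndf.
have cv c : f (c + (k_ n)^-1) @[n --> \oo] --> f c.
  have ck : c + (k_ n)^-1 @[n --> \oo] --> c.
    by rewrite -[X in _ --> X]addr0; apply: cvgD => //; exact: cvg_cst.
  exact: (cvg_comp _ _ ck (cf c)).
have nb : \forall n \near \oo, f b - f (a + (k_ n)^-1) <=
    - (\int[mu]_x (f x * dplateau (k_ n) a b x)) <= f (b + (k_ n)^-1) - f a.
  by apply: nearW => n; exact: integral_dplateauM_bounds.
apply: (squeeze_cvgr nb).
- by apply: cvgB => //; exact: cvg_cst.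
- by apply: cvgB => //; exact: cvg_cst.
Qed.

Lemma diamond_rot a b c d : diamond a b c d = @rot R @^-1` (`[a, b] `*` `[c, d]).
Proof.
apply/seteqP; split => p /=; rewrite !in_itv/=; first by move=> /andP[].
by case=> h1 h2; apply/andP.
Qed.

Lemma measurable_preimage_rot (X : set (RB * RB)) : measurable X ->
  measurable (@rot R @^-1` X).
Proof.
by move=> mX; rewrite -[X in measurable X]setTI; exact: measurable_rot.
Qed.

Lemma measurable_diamond a b c d : measurable (diamond a b c d : set (RB * RB)).
Proof.
by rewrite diamond_rot; apply: measurable_preimage_rot; exact: measurableX.
Qed.

Lemma plane_measure_diamond_fin a b c d : (P (diamond a b c d) < +oo)%E.
Proof.
rewrite diamond_rot ltNge leye_eq; apply/negP => /eqP E.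
have := @plane_measure_rot_setX R `[a, b] `[c, d].
rewrite E => /(_ (measurable_itv _) (measurable_itv _)).
rewrite mulry gtr0_sg// mul1e !lebesgue_measure_itv/=.
by case: ifPn => _; case: ifPn => _; rewrite ?mul0e ?mule0.
Qed.

Lemma measurable_upper_half_plane : measurable (H : set (RB * RB)).
Proof.
rewrite (_ : H = snd @^-1` `]0, +oo[).
  by rewrite -[X in measurable X]setTI; exact: measurable_snd.
by apply/seteqP; split => p; rewrite /upper_half_plane/= in_itv/= andbT.
Qed.

(** On a set of finite measure |w| <= 1 + |w|^2 gives integrability. *)
Lemma L2loc_integrable_diamond (w : R * R -> R) a b c d : d < a ->
  L2loc H w -> P.-integrable (diamond a b c d) (EFin \o w).
Proof.
move=> da [mw L2].
have mK := measurable_diamond a b c d.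
have KH := @diamond_upper R a b c d da.
have mwK : measurable_fun (diamond a b c d : set (RB * RB)) w.
  by apply: measurable_funS mw => //; exact: measurable_upper_half_plane.
have mw2 : measurable_fun (diamond a b c d : set (RB * RB)) (fun p => `|w p| ^+ 2).
  by apply: measurable_funX; exact: measurableT_comp.
have i2 : P.-integrable (diamond a b c d) (EFin \o (fun p => `|w p| ^+ 2)).
  apply/integrableP; split; first exact/measurable_EFinP.
  under eq_integral do rewrite /= ger0_norm ?sqr_ge0//.
  by apply: L2 => //; exact: compact_diamond.
have i1 : P.-integrable (diamond a b c d) (EFin \o cst (1 : R)).
  apply/integrableP; split; first exact/measurable_EFinP/measurable_cst.
  under eq_integral do rewrite /= normr1.
  by rewrite integral_cst// mul1e plane_measure_diamond_fin.
apply: (le_integrable mK _ _ (integrableD mK i1 i2)).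
  exact/measurable_EFinP.
move=> p _ /=; rewrite lee_fin [leRHS]ger0_norm ?addr_ge0 ?sqr_ge0//.
by have := sqr_ge0 (`|w p| - 1); have := normr_ge0 (w p); nra.
Qed.

(** The half-open version of [diamond], matching both the limits of the plateaus and the intervals
    on which Stieltjes measures are computed. *)
Definition rect a b c d : set (RB * RB) := @rot R @^-1` (`]a, b] `*` `]c, d]).

Lemma measurable_rect a b c d : measurable (rect a b c d).
Proof. by apply: measurable_preimage_rot; exact: measurableX. Qed.

Lemma rect_diamond a b c d : rect a b c d `<=` diamond a b c d.
Proof.
by move=> p; rewrite /rect /diamond /rot/= !in_itv/= => -[/andP[/ltW-> ->] /andP[/ltW-> ->]].
Qed.

(** Dominated convergence: |w| restricted to the diamond enlarged by [e] dominates, and [d + e < a]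
    keeps that diamond inside the half-plane. *)
Lemma integral_sep_plateau_cvg (w : R * R -> R) a b c d e (k_ : nat -> R) :
  L2loc H w -> (forall n, 0 < k_ n) -> (k_ n)^-1 @[n --> \oo] --> 0 ->
  (forall n, (k_ n)^-1 <= e) -> a <= b -> c <= d -> d + e < a ->
  \int[P]_(p in H) (w p * sep (plateau (k_ n) a b) (plateau (k_ n) c d) p)
    @[n --> \oo] --> \int[P]_(p in rect a b c d) w p.
Proof.
move=> L2w k0 kcvg ke ab cd dea.
have mH := measurable_upper_half_plane.
have e0 : 0 < e by rewrite (lt_le_trans _ (ke 0%N))// invr_gt0.
set K := diamond a (b + e) c (d + e).
have KH : K `<=` H by exact: diamond_upper.
have mK : measurable (K : set (RB * RB)) by exact: measurable_diamond.
have rH : rect a b c d `<=` H.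
  by apply: subset_trans (diamond_upper _); [exact: rect_diamond|lra].
have -> : \int[P]_(p in rect a b c d) w p =
    \int[P]_(p in H) (w p * (\1_(`]a, b]) (p.1 + p.2) * \1_(`]c, d]) (p.1 - p.2))).
  rewrite -{1}(setIidr rH) Rintegral_mkcondr; apply: eq_Rintegral => p _.
  rewrite patchE !indicE -natrM mulnb.
  case: (boolP (p \in _)) => [/set_mem[/= h1 h2]|].
    by rewrite !mem_setE h1 h2 mulr1.
  case: (boolP (_ && _)) => [/andP[/set_mem h1 /set_mem h2]|_ _]; last by rewrite mulr0.
  by move/negP; case; apply/mem_set.
have mw : measurable_fun (H : set (RB * RB)) w by case: L2w.
have iw : P.-integrable K (EFin \o w) by exact: L2loc_integrable_diamond.
apply: (@Rintegral_dominated_cvg _ _ P H _ _ ((fun p => `|w p|) \_ K)) => //.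
- move=> n; apply: measurable_funM => //.
  have mpl x y : measurable_fun [set: RB] (plateau (k_ n) x y : RB -> RB).
    apply: continuous_measurable_fun.
    exact: smooth_continuous (smooth_plateau 0 _ _ _).
  apply: measurable_funTS; apply: measurable_funM.
    apply: (measurableT_comp (mpl a b)).
    by apply: measurable_funD; [exact: measurable_fst|exact: measurable_snd].
  apply: (measurableT_comp (mpl c d)).
  by apply: measurable_funB; [exact: measurable_fst|exact: measurable_snd].
- move=> p _; apply: cvgM; first exact: cvg_cst.
  by apply: cvgM; exact: plateau_cvg.
- have iK : P.-integrable setT ((EFin \o (fun p => `|w p|)) \_ K).
    by apply: (iffLR (integrable_mkcond _ mK)); exact: (integrable_norm iw).
  rewrite -restrict_EFin; exact: integrableS iK.
move=> n p _; rewrite patchE; case: ifPn => [pK|pK].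
  by rewrite normrM ler_piMr// normrM mulr_ile1// plateau_norm_le1.
suff -> : sep (plateau (k_ n) a b) (plateau (k_ n) c d) p = 0 by rewrite mulr0 normr0.
have H1 x y z : x <= z <= y + (k_ n)^-1 -> x <= z <= y + e.
  by move=> /andP[-> h]; rewrite (le_trans h)// lerD2l.
rewrite /sep.
have [h1|h1] := boolP (a <= p.1 + p.2 <= b + (k_ n)^-1); last first.
  by rewrite plateau_out ?mul0r.
have [h2|h2] := boolP (c <= p.1 - p.2 <= d + (k_ n)^-1); last first.
  by rewrite [X in _ * X]plateau_out ?mulr0.
by move/negP: pK; case; apply/mem_set; rewrite /K /diamond/=; apply/andP; split; exact: H1.
Qed.

End Limits.

(** * Integrals of weak derivatives over boxes *)

Section WeakDerivatives.
Variable R : realType.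
Local Notation mu := (@lebesgue_measure R).
Local Notation RB := (measurableTypeR R).
Local Notation P := (@plane_measure R).
Local Notation H := (@upper_half_plane R).
Implicit Types a b c d e : R.

Lemma integrable_linear2 disp (T : measurableType disp)
    (m : {measure set T -> \bar R}) (D : set T) (F G : T -> R) c d :
  measurable D -> m.-integrable D (EFin \o F) -> m.-integrable D (EFin \o G) ->
  m.-integrable D (EFin \o (fun x => c * F x + d * G x)).
Proof.
move=> mD iF iG.
by apply: eq_integrable (integrableD mD (integrableZl mD c iF) (integrableZl mD d iG)).
Qed.

Lemma Rintegral_linear2 disp (T : measurableType disp)
    (m : {measure set T -> \bar R}) (D : set T) (F G : T -> R) c d :
  measurable D -> m.-integrable D (EFin \o F) -> m.-integrable D (EFin \o G) ->
  \int[m]_(x in D) (c * F x + d * G x) =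
  c * \int[m]_(x in D) F x + d * \int[m]_(x in D) G x.
Proof.
move=> mD iF iG; rewrite -(RintegralZl c mD iF) -(RintegralZl d mD iG).
by rewrite -(RintegralD mD (integrableZl mD c iF) (integrableZl mD d iG)).
Qed.

(* For s = 1 and s = -1 the function below is the first and the second component
   of E_NS f.  The two mixed terms of the product rule drop out because dplateau
   has integral 0. *)
Lemma weak_derivative_plateau (f : R -> R) (s : R) (v : R * R) (g : R * R -> R)
    a b c d k : continuous f ->
  weak_derivative H v (fun p => (f (p.1 + p.2) + s * f (p.1 - p.2)) / 2) g ->
  0 < k -> a <= b -> c <= d -> d + k^-1 < a ->
  \int[P]_(p in H) (g p * sep (plateau k a b) (plateau k c d) p) =
  - ((v.1 + v.2) * ((\int[mu]_x (f x * dplateau k a b x)) *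
       (\int[mu]_x plateau k c d x)) +
     s * (v.1 - v.2) * ((\int[mu]_x plateau k a b x) *
       (\int[mu]_x (f x * dplateau k c d x)))) / 4.
Proof.
move=> cf wg k0 ab cd da.
have cP x y : continuous (plateau k x y).
  exact: smooth_continuous (smooth_plateau 0 k x y).
have cdP x y : continuous (dplateau k x y) by exact: continuous_dplateau.
have cM (F G : R -> R) : continuous F -> continuous G ->
    continuous (fun x => F x * G x).
  by move=> cF cG x; apply: cvgM; [exact: cF|exact: cG].
have test : test_function H (sep (plateau k a b) (plateau k c d)).
  apply: (test_function_sep da).
  - by move=> n; exact: smooth_plateau.
  - by move=> n; exact: smooth_plateau.
  - by move=> x; exact: plateau_out.
  - by move=> x; exact: plateau_out.
have := wg _ test => /esym/eqP; rewrite eqr_oppLR => /eqP ->.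
rewrite mulNr; congr (- _).
have Dv p : 'D_v (sep (plateau k a b) (plateau k c d)) p =
    sep (dplateau k a b) (plateau k c d) p * (v.1 + v.2) +
    sep (plateau k a b) (dplateau k c d) p * (v.1 - v.2).
  have := is_derive_sep p v (is_derive_plateau k a b) (is_derive_plateau k c d).
  by move=> dv; exact: derive_val.
have out x y : x <= y -> forall z, ~~ (x <= z <= y + k^-1) ->
    plateau k x y z = 0 /\ dplateau k x y z = 0.
  by move=> xy z zxy; rewrite plateau_out ?dplateau_out.
have iP x y : x <= y -> mu.-integrable setT (EFin \o plateau k x y).
  by move=> xy; apply: (@integrable_itv_supp _ _ x (y + k^-1)) => // z /(out _ _ xy)[].
have idP x y : x <= y -> mu.-integrable setT (EFin \o dplateau k x y).
  by move=> xy; apply: (@integrable_itv_supp _ _ x (y + k^-1)) => // z /(out _ _ xy)[].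
have ifP x y : x <= y -> mu.-integrable setT (EFin \o (fun z => f z * plateau k x y z)).
  move=> xy; apply: (@integrable_itv_supp _ _ x (y + k^-1)); first exact: cM.
  by move=> z /(out _ _ xy)[-> _]; rewrite mulr0.
have ifdP x y : x <= y -> mu.-integrable setT (EFin \o (fun z => f z * dplateau k x y z)).
  move=> xy; apply: (@integrable_itv_supp _ _ x (y + k^-1)); first exact: cM.
  by move=> z /(out _ _ xy)[_ ->]; rewrite mulr0.
(* [F1] and [F4] carry [f] on the differentiated factor; [F2] and [F3] are the mixed terms. *)
pose F1 := sep (fun z => f z * dplateau k a b z) (plateau k c d).
pose F2 := sep (dplateau k a b) (fun z => f z * plateau k c d z).
pose F3 := sep (fun z => f z * plateau k a b z) (dplateau k c d).
pose F4 := sep (plateau k a b) (fun z => f z * dplateau k c d z).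
have iF1 : P.-integrable setT (EFin \o F1) by apply: integrable_sep; [exact: ifdP|exact: iP].
have iF2 : P.-integrable setT (EFin \o F2) by apply: integrable_sep; [exact: idP|exact: ifP].
have iF3 : P.-integrable setT (EFin \o F3) by apply: integrable_sep; [exact: ifP|exact: idP].
have iF4 : P.-integrable setT (EFin \o F4) by apply: integrable_sep; [exact: iP|exact: ifdP].
pose G1 p := (v.1 + v.2) / 2 * F1 p + s * (v.1 + v.2) / 2 * F2 p.
pose G2 p := (v.1 - v.2) / 2 * F3 p + s * (v.1 - v.2) / 2 * F4 p.
have iG1 : P.-integrable setT (EFin \o G1) by exact: integrable_linear2.
have iG2 : P.-integrable setT (EFin \o G2) by exact: integrable_linear2.
transitivity (\int[P]_p (1 * G1 p + 1 * G2 p)).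
  rewrite Rintegral_mkcond; apply: eq_Rintegral => p _.
  rewrite patchE; case: ifPn => [_|pH].
    rewrite Dv /G1 /G2 /F1 /F2 /F3 /F4 /sep /=.
    move: (plateau k a b _) (dplateau k a b _) (plateau k c d _) (dplateau k c d _).
    by move: (f _) (f _) => f1 f2 x1 x2 x3 x4; field.
  (* Off the half-plane, s or t lies outside its support interval, so the integral extends to the
     whole plane without change. *)
  have : (plateau k a b (p.1 + p.2) = 0 /\ dplateau k a b (p.1 + p.2) = 0) \/
      (plateau k c d (p.1 - p.2) = 0 /\ dplateau k c d (p.1 - p.2) = 0).
    have [h1|h1] := boolP (a <= p.1 + p.2 <= b + k^-1); last by left; exact: out.
    have [h2|h2] := boolP (c <= p.1 - p.2 <= d + k^-1); last by right; exact: out.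
    move/negP: pH; case; apply/mem_set.
    apply: (@diamond_upper R a (b + k^-1) c (d + k^-1)) => //.
    by rewrite /diamond/= h1.
  by rewrite /G1 /G2 /F1 /F2 /F3 /F4 /sep /= => -[[-> ->]|[-> ->]];
     rewrite ?(mulr0, mul0r, addr0).
have E1 := integral_sep (ifdP _ _ ab) (iP _ _ cd).
have E2 := integral_sep (idP _ _ ab) (ifP _ _ cd).
have E3 := integral_sep (ifP _ _ ab) (idP _ _ cd).
have E4 := integral_sep (iP _ _ ab) (ifdP _ _ cd).
have Z1 := integral_dplateau a b k0; have Z2 := integral_dplateau c d k0.
rewrite (Rintegral_linear2 1 1 measurableT iG1 iG2).
rewrite (Rintegral_linear2 _ _ measurableT iF1 iF2).
rewrite (Rintegral_linear2 _ _ measurableT iF3 iF4).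
(* The denominator 4 is made of the 1/2 in [E_NS] and the 1/2 of [integral_sep]. Abstract reals keep
   the integrals out of [field]. *)
have combine (I1 I2 I3 I4 A1 A2 A3 A4 A5 A6 z1 z2 : R) :
    I1 = A1 * A2 / 2 -> I2 = z1 * A4 / 2 -> I3 = A3 * z2 / 2 ->
    I4 = A5 * A6 / 2 -> z1 = 0 -> z2 = 0 ->
    1 * ((v.1 + v.2) / 2 * I1 + s * (v.1 + v.2) / 2 * I2) +
    1 * ((v.1 - v.2) / 2 * I3 + s * (v.1 - v.2) / 2 * I4) =
    ((v.1 + v.2) * (A1 * A2) + s * (v.1 - v.2) * (A5 * A6)) / 4.
  by move=> -> -> -> -> -> ->; field.
exact: (combine _ _ _ _ _ _ _ _ _ _ _ _ E1 E2 E3 E4 Z1 Z2).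
Qed.

Lemma integral_rect_weak_derivative (f : R -> R) (s : R) (v : R * R)
    (g : R * R -> R) a b c d : continuous f -> {homo f : x y / x <= y} ->
  weak_derivative H v (fun p => (f (p.1 + p.2) + s * f (p.1 - p.2)) / 2) g ->
  L2loc H g -> a <= b -> c <= d -> d < a ->
  \int[P]_(p in rect a b c d) g p =
  ((v.1 + v.2) * ((f b - f a) * (d - c)) +
   s * (v.1 - v.2) * ((b - a) * (f d - f c))) / 4.
Proof.
move=> cf ndf wg L2g ab cd da.
(* Half the gap between the two intervals bounds the ramp lengths e / (n + 1), so all supports
   remain in the half-plane. *)
pose e := (a - d) / 2; have e0 : 0 < e by rewrite divr_gt0// subr_gt0.
pose k_ (n : nat) : R := e^-1 * n.+1%:R.
have k0 n : 0 < k_ n by rewrite mulr_gt0// invr_gt0.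
have kE n : (k_ n)^-1 = e * n.+1%:R^-1 by rewrite /k_ invfM invrK.
have ke n : (k_ n)^-1 <= e.
  by rewrite kE ger_pMr// invf_le1// ler1n.
have kcvg : (k_ n)^-1 @[n --> \oo] --> 0.
  rewrite (_ : (fun n => _) = fun n => e * n.+1%:R^-1); last exact/funext.
  have : e * n.+1%:R^-1 @[n --> \oo] --> e * 0.
    by apply: cvgM; [exact: cvg_cst|exact: cvg_harmonic].
  by rewrite mulr0.
have dea : d + e < a by rewrite /e; lra.
have cv := integral_sep_plateau_cvg L2g k0 kcvg ke ab cd dea.
have dk n : d + (k_ n)^-1 < a by rewrite (le_lt_trans _ dea)// lerD2l.
have E n := weak_derivative_plateau cf wg (k0 n) ab cd (dk n).
rewrite (eq_cvg _ _ E) in cv.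
apply: (cvg_unique _ cv) => //.
apply: cvgM; last exact: cvg_cst.
have cA := @integral_dplateauM_cvg _ a b _ _ k0 kcvg cf ndf.
have cB := @integral_dplateauM_cvg _ c d _ _ k0 kcvg cf ndf.
have cE := integral_plateau_cvg k0 kcvg ke ab.
have cT := integral_plateau_cvg k0 kcvg ke cd.
rewrite (_ : (fun n => _) = (fun n =>
  (v.1 + v.2) * (- (\int[mu]_x (f x * dplateau (k_ n) a b x)) *
    \int[mu]_x plateau (k_ n) c d x) +
  s * (v.1 - v.2) * ((\int[mu]_x plateau (k_ n) a b x) *
    - (\int[mu]_x (f x * dplateau (k_ n) c d x))))); last first.
  by apply/funext => n; rewrite !mulrN !mulNr mulrN opprD.
apply: cvgD.
  by apply: cvgM; [exact: cvg_cst|exact: cvgM].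
by apply: cvgM; [exact: cvg_cst|exact: cvgM].
Qed.

End WeakDerivatives.

(** * From integrals over boxes to pointwise bounds *)

Section Positivity.
Variable R : realType.
Local Notation mu := (@lebesgue_measure R).
Local Notation RB := (measurableTypeR R).
Local Notation P := (@plane_measure R).
Local Notation H := (@upper_half_plane R).
Implicit Types a b c d : R.

Definition boxes : set (set (RB * RB)) :=
  [set X | exists a b c d, X = `]a, b] `*` `]c, d]].

Lemma measurable_boxes : (measurable : set (set (RB * RB))) = <<s boxes >>.
Proof.
pose T := g_sigma_algebraType boxes.
have mbox a b c d : measurable (`]a, b] `*` `]c, d] : set T).
  by apply: sub_sigma_algebra; exists a, b, c, d.
(* A strip is a countable union of boxes, so both projections are measurable for the sigma-algebra
   generated by boxes. *)
have exhaust : \bigcup_n [set` `](- (n%:R : R)), n%:R]] = setT.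
  rewrite -subTset => x _; exists (Num.bound `|x|) => //=; rewrite in_itv/=.
  have := archi_boundP (normr_ge0 x); rewrite ltr_norml => /andP[-> /ltW ->] //.
have mfst : measurable_fun [set: T] (fst : T -> RB).
  apply: (measurability (@ocitv R)) => // _ [_ [[a b] _ <-] <-]; rewrite setTI /=.
  rewrite -setXT -exhaust setX_bigcupr.
  by apply: bigcupT_measurable => n; exact: mbox.
have msnd : measurable_fun [set: T] (snd : T -> RB).
  apply: (measurability (@ocitv R)) => // _ [_ [[a b] _ <-] <-]; rewrite setTI /=.
  rewrite -setTX -exhaust setX_bigcupl.
  by apply: bigcupT_measurable => n; exact: mbox.
apply/seteqP; split.
  apply: smallest_sub; first exact: smallest_sigma_algebra.
  by move=> X [|] [A mA <-]; [exact: mfst|exact: msnd].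
apply: smallest_sub; first exact: sigma_algebra_measurable.
by move=> _ [a [b [c [d ->]]]]; exact: measurableX.
Qed.

Lemma boxes_setI : setI_closed boxes.
Proof.
move=> _ _ [a [b [c [d ->]]]] [a' [b' [c' [d' ->]]]].
rewrite -setXI; exists (Num.max a a'), (Num.min b b'), (Num.max c c'), (Num.min d d').
congr (_ `*` _); apply/seteqP; split => x /=; rewrite !in_itv/= gt_max le_min.
- by move=> [/andP[-> ->] /andP[-> ->]].
- by move=> /andP[/andP[-> ->] /andP[-> ->]].
- by move=> [/andP[-> ->] /andP[-> ->]].
- by move=> /andP[/andP[-> ->] /andP[-> ->]].
Qed.

(** The integral formula is available only for ordered endpoints inside the ambient box. An empty
    intersection is represented by the degenerate interval ]b0, b0]. *)
Lemma itv_clip a0 b0 a b : a0 <= b0 -> exists x y, [/\ a0 <= x, x <= y, y <= b0 &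
  `]a0, b0] `&` `]a, b] = `]x, y]%classic].
Proof.
move=> ab0; have [xy|yx] := leP (Num.max a0 a) (Num.min b0 b).
  exists (Num.max a0 a), (Num.min b0 b); split => //.
  - by rewrite le_max lexx.
  - by rewrite ge_min lexx.
  apply/seteqP; split => x /=; rewrite !in_itv/= gt_max le_min.
    by move=> [/andP[-> ->] /andP[-> ->]].
  by move=> /andP[/andP[-> ->] /andP[-> ->]].
exists b0, b0; split => //; apply/seteqP; split => x /=; rewrite !in_itv/=.
  move=> [/andP[h1 h2] /andP[h3 h4]].
  have : Num.max a0 a < Num.min b0 b by rewrite (@lt_le_trans _ _ x) ?gt_max ?h1// le_min h2.
  by move=> /(lt_trans yx); rewrite ltxx.
by move=> /andP[h1 h2]; move: (lt_le_trans h1 h2); rewrite ltxx.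
Qed.

(* The sets over which w integrates to m form a Dynkin class; apply the equality
   to the set where w < 0. *)
Lemma ae_ge0_rect (w : RB * RB -> R) (m : {measure set (RB * RB) -> \bar R})
    a0 b0 c0 d0 : a0 <= b0 -> c0 <= d0 ->
  P.-integrable (rect a0 b0 c0 d0) (EFin \o w) ->
  (forall a b c d, a0 <= a -> a <= b -> b <= b0 -> c0 <= c -> c <= d -> d <= d0 ->
     (\int[P]_(p in rect a b c d) w p)%:E = m (`]a, b] `*` `]c, d])) ->
  {ae P, forall p, rect a0 b0 c0 d0 p -> 0 <= w p}.
Proof.
move=> ab0 cd0 iw hw; set Q := rect a0 b0 c0 d0.
pose Q0 : set (RB * RB) := `]a0, b0] `*` `]c0, d0].
have mQ : measurable Q by exact: measurable_rect.
have mQ0 : measurable Q0 by exact: measurableX.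
have mrot X : measurable X -> measurable (@rot R @^-1` X) by exact: measurable_preimage_rot.
have iwS X : measurable X -> P.-integrable (Q `&` @rot R @^-1` X) (EFin \o w).
  move=> mX; apply: integrableS iw => //; first by apply: measurableI => //; exact: mrot.
pose good X := (\int[P]_(p in Q `&` @rot R @^-1` X) (w p)%:E)%E = m (Q0 `&` X).
have goodT : good setT.
  by rewrite /good preimage_setT !setIT -hw// fineK//; exact: integrable_fin_num.
have addIfin (x y z : \bar R) : x \is a fin_num -> (x + y = x + z)%E -> y = z.
  by case: x => [x| |]//; case: y z => [y| |] [z| |]//= _ [] /addrI ->.
have goodE X : measurable X -> good X.
  rewrite {1}measurable_boxes; apply: (dynkin_induction measurable_boxes boxes_setI) => //.
  - move=> _ [a [b [c [d ->]]]]; rewrite /good -preimage_setI -setXI.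
    have [x [y [h1 h2 h3 E1]]] := itv_clip a b ab0.
    have [z [t [h4 h5 h6 E2]]] := itv_clip c d cd0.
    rewrite E1 E2 -hw// fineK//; apply: integrable_fin_num; first exact: measurable_rect.
    rewrite /rect -E1 -E2 setXI preimage_setI; apply: iwS; exact: measurableX.
  (* Complements: both sides are additive over [S] and its complement, and the integral over the [S]
     part, being finite, cancels. *)
  - move=> S mS gS.
    have mS' := measurableC mS.
    have QE : Q = (Q `&` @rot R @^-1` S) `|` (Q `&` @rot R @^-1` (~` S)).
      by rewrite -setIUr -preimage_setU setUCr preimage_setT setIT.
    have Q0E : Q0 = (Q0 `&` S) `|` (Q0 `&` ~` S).
      by rewrite -setIUr setUCr setIT.
    have dj (T : Type) (U V W : set T) : V `&` W = set0 -> (U `&` V) `&` (U `&` W) = set0.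
      by move=> VW; rewrite setIACA VW setI0.
    have intE : (\int[P]_(p in Q) (w p)%:E =
        \int[P]_(p in Q `&` @rot R @^-1` S) (w p)%:E +
        \int[P]_(p in Q `&` @rot R @^-1` (~` S)) (w p)%:E)%E.
      rewrite {1}QE integral_setU//.
      - by apply: measurableI => //; exact: mrot.
      - by apply: measurableI => //; exact: mrot.
      - by rewrite -QE; exact: measurable_int iw.
      - by apply/disj_set2P; rewrite dj// -preimage_setI setICr preimage_set0.
    have mE : m Q0 = (m (Q0 `&` S) + m (Q0 `&` ~` S))%E.
      rewrite {1}Q0E measureU//; [exact: measurableI|exact: measurableI|].
      by rewrite dj// setICr.
    move: goodT; rewrite /good preimage_setT !setIT intE mE -gS.
    apply: addIfin.
    by apply: integrable_fin_num; [apply: measurableI => //; exact: mrot|exact: iwS].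
  - move=> F mF tF gF.
    have mU : measurable (\bigcup_k F k) by exact: bigcupT_measurable.
    rewrite /good preimage_bigcup !setI_bigcupr integral_bigcup//.
    + rewrite measure_semi_bigcup//.
      * by apply: eq_eseriesr => k _; exact: gF.
      * by move=> k; exact: measurableI.
      * exact: trivIset_setIl.
      * by rewrite -setI_bigcupr; exact: measurableI.
    + apply/trivIsetP => i j _ _ ij.
      move/trivIsetP : tF => /(_ i j I I ij) FF.
      apply/seteqP; split => // p [[_ h1] [_ h2]].
      by suff : set0 (rot p) by []; rewrite -FF; split.
    + by move=> k; apply: measurableI => //; exact: mrot.
    + by rewrite -setI_bigcupr -preimage_bigcup; exact: iwS.
(* [sg] inverts [rot]; it turns the set where [w < 0] into one of the form required by [good]. *)
pose sg (q : RB * RB) : RB * RB := (2^-1 * (q.1 + q.2), 2^-1 * (q.1 - q.2)).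
have rotK p : sg (rot p) = p.
  by case: p => x y; rewrite /sg /rot /=; congr (_, _); field.
have msg : measurable_fun setT sg.
  apply/measurable_fun_pairP; split; apply: measurable_funM => //.
    exact: (measurable_funD measurable_fst measurable_snd).
  exact: (measurable_funB measurable_fst measurable_snd).
have mwQ : measurable_fun Q w by apply/measurable_EFinP; exact: measurable_int iw.
pose N := Q `&` w @^-1` `]-oo, 0[.
have mN : measurable N by exact: mwQ.
have mX : measurable (sg @^-1` N) by rewrite -[X in measurable X]setTI; exact: msg.
have QN : Q `&` @rot R @^-1` (sg @^-1` N) = N.
  by apply/seteqP; split => p; rewrite /= rotK; [case|move=> Np; split => //; case: Np].
have iN : P.-integrable N (EFin \o w) by rewrite -QN; exact: iwS.
(* On [N] the integral of |w| is minus that of [w], hence minus a value of [m], hence at most 0. *)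
have wN0 : (\int[P]_(p in N) `|(w p)%:E| = 0)%E.
  apply/eqP; rewrite eq_le integral_ge0// andbT.
  have -> : (\int[P]_(p in N) `|(w p)%:E| = - \int[P]_(p in N) (w p)%:E)%E.
    rewrite -integralN; last exact: integrable_add_def iN.
    apply: eq_integral => p /set_mem[_]; rewrite /= in_itv/= => wp.
    by rewrite ltr0_norm.
  by rewrite leeNl oppe0 -{1}QN goodE.
have mwN : measurable_fun N (EFin \o w) by exact: measurable_int iN.
have := (ae_eq_integral_abs _ mN mwN).1 wN0; apply: filterS => p /= Np0 Qp.
rewrite leNgt; apply/negP => wp.
have [] : (w p)%:E = 0%E by apply: Np0; split => //=; rewrite in_itv.
by move=> wp0; rewrite wp0 ltxx in wp.
Qed.

End Positivity.

(** * Pointwise form of the weak derivatives and comparison of slopes *)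

Section Comparison.
Variable R : realType.
Local Notation mu := (@lebesgue_measure R).
Local Notation RB := (measurableTypeR R).
Local Notation P := (@plane_measure R).
Local Notation H := (@upper_half_plane R).
Implicit Types (a b c d k x y : R) (f : R -> R).

Lemma Rintegral_ae_ge0 disp (T : measurableType disp)
    (m : {measure set T -> \bar R}) (D : set T) (w : T -> R) :
  measurable D -> m.-integrable D (EFin \o w) ->
  {ae m, forall p, D p -> 0 <= w p} -> 0 <= \int[m]_(p in D) w p.
Proof.
move=> mD iw w0; have mw : measurable_fun D (EFin \o w) by exact: measurable_int iw.
have mwn : measurable_fun D (EFin \o (fun p => `|w p|)).
  by apply/measurable_EFinP; apply: measurableT_comp => //; exact/measurable_EFinP.
suff -> : \int[m]_(p in D) w p = \int[m]_(p in D) `|w p| by exact: Rintegral_ge0.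
congr fine; apply: ae_eq_integral => //; apply: filterS w0 => p w0 Dp /=.
by rewrite ger0_norm// w0.
Qed.

(** When the y-derivative is the x-derivative with its components swapped, [d_z] equals x and
    [d_zbar] equals i y. For [E_NS f] these components stand for (f'(s) + f'(t)) / 2 and (f'(s) -
    f'(t)) / 2. *)
Lemma cauchy_riemann_dilatation k x y :
  (`|d_zbar (x, y) (y, x)| <= k%:C * `|d_z (x, y) (y, x)|)%C -> `|y| <= k * `|x|.
Proof.
have -> : d_z (x, y) (y, x) = (x%:C)%C.
  by apply/eqP; rewrite eq_complex /=; apply/andP; split; apply/eqP; field.
have -> : d_zbar (x, y) (y, x) = (0 +i* y)%C.
  by apply/eqP; rewrite eq_complex /=; apply/andP; split; apply/eqP; field.
rewrite !normc_def /= !expr0n /= addr0 add0r !sqrtr_sqr.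
by rewrite -rmorphM lecR.
Qed.

Lemma lebesgue_stieltjes_measure_itvoc (F : cumulative R R) a b : a <= b ->
  lebesgue_stieltjes_measure F `]a, b] = (F b - F a)%:E.
Proof.
move=> ab; rewrite /lebesgue_stieltjes_measure /measure_extension/=.
by rewrite measurable_mu_extE/= ?wlength_itv_bnd//; exact: is_ocitv.
Qed.

Section WeakFields.
Variables (f : R -> R) (Fx Fy : R * R -> R * R).
Hypotheses (cf : continuous f) (ndf : {homo f : x y / x <= y}).
Hypothesis sobolev : W12loc_map H (E_NS f) Fx Fy.

Let components :
  [/\ L2loc H (fst \o Fx), L2loc H (fst \o Fy), L2loc H (snd \o Fx) &
      L2loc H (snd \o Fy)].
Proof. by case: sobolev => -[_ ? ? _ _] [_ ? ? _ _]. Qed.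

Lemma integrable_rect (w : R * R -> R) a b c d : d < a -> L2loc H w ->
  P.-integrable (rect a b c d) (EFin \o w).
Proof.
move=> da L2w; apply: integrableS (L2loc_integrable_diamond b c da L2w).
- exact: measurable_diamond.
- exact: measurable_rect.
- exact: rect_diamond.
Qed.

(** Formally, [X / 2] and [Y / 2] are the integrals of f'(s) and f'(t) over the rectangle. *)
Let integral_components a b c d (X := (f b - f a) * (d - c))
    (Y := (b - a) * (f d - f c)) : a <= b -> c <= d -> d < a ->
  [/\ \int[P]_(p in rect a b c d) (Fx p).1 = (X + Y) / 4,
      \int[P]_(p in rect a b c d) (Fy p).1 = (X - Y) / 4,
      \int[P]_(p in rect a b c d) (Fx p).2 = (X - Y) / 4 &
      \int[P]_(p in rect a b c d) (Fy p).2 = (X + Y) / 4].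
Proof.
move=> ab cd da; have [L1 L2 L3 L4] := components.
have [[_ _ _ w1 w2] [_ _ _ w3 w4]] := sobolev.
have Eu : fst \o E_NS f = fun p => (f (p.1 + p.2) + 1 * f (p.1 - p.2)) / 2.
  by apply/funext => p; rewrite /= mul1r.
have Ev : snd \o E_NS f = fun p => (f (p.1 + p.2) + (- 1) * f (p.1 - p.2)) / 2.
  by apply/funext => p; rewrite /= mulN1r.
rewrite Eu in w1 w2; rewrite Ev in w3 w4.
have I1 := integral_rect_weak_derivative cf ndf w1 L1 ab cd da.
have I2 := integral_rect_weak_derivative cf ndf w2 L2 ab cd da.
have I3 := integral_rect_weak_derivative cf ndf w3 L3 ab cd da.
have I4 := integral_rect_weak_derivative cf ndf w4 L4 ab cd da.
split.
- by rewrite I1 /= -/X -/Y; congr (_ / _); ring.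
- by rewrite I2 /= -/X -/Y; congr (_ / _); ring.
- by rewrite I3 /= -/X -/Y; congr (_ / _); ring.
- by rewrite I4 /= -/X -/Y; congr (_ / _); ring.
Qed.

(** The Dynkin argument for a linear combination of weak derivatives: the sign follows once its
    integrals over boxes are the values of some measure. *)
Let ae_ge0_combination (u w : R * R -> R) (s t : R)
    (m : {measure set (RB * RB) -> \bar R}) a0 b0 c0 d0 :
  a0 <= b0 -> c0 <= d0 -> d0 < a0 -> L2loc H u -> L2loc H w ->
  (forall a b c d, a <= b -> c <= d -> d < a ->
    (s * (\int[P]_(p in rect a b c d) u p) +
     t * (\int[P]_(p in rect a b c d) w p))%:E = m (`]a, b] `*` `]c, d])) ->
  {ae P, forall p, rect a0 b0 c0 d0 p -> 0 <= s * u p + t * w p}.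
Proof.
move=> ab0 cd0 da0 L2u L2w hm.
have ir a b c d : d < a -> P.-integrable (rect a b c d)
    (EFin \o (fun p => s * u p + t * w p)).
  move=> da; apply: integrable_linear2; first exact: measurable_rect.
    exact: integrable_rect.
  exact: integrable_rect.
apply: (@ae_ge0_rect _ _ m) => //; first exact: ir.
move=> a b c d a0a ab bb0 c0c cd dd0.
have da : d < a by rewrite (le_lt_trans dd0)// (lt_le_trans da0).
rewrite -hm// Rintegral_linear2//; first exact: measurable_rect.
  exact: integrable_rect.
exact: integrable_rect.
Qed.

Let F_cumulative : cumulative R R :=
  HB.pack f (isCumulative.Build R _ R f ndf (right_continuousW cf)).

Let half : {nonneg R} := NngNum (divr_ge0 (@ler01 R) (ler0n R 2)).

(** These measures represent f'(s) and f'(t) in the coordinates (s, t); the 1/2 is again the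
    Jacobian. *)
Let half_product_measure (m1 m2 : {sigma_finite_measure set RB -> \bar R}) :
  exists m : {measure set (RB * RB) -> \bar R}, forall A B,
    measurable A -> measurable B -> m (A `*` B) = ((1 / 2)%:E * (m1 A * m2 B))%E.
Proof.
exists (mscale half (m1 \x m2)%E) => A B mA mB.
transitivity ((1 / 2)%:E * (m1 \x m2) (A `*` B))%E; first by [].
by rewrite product_measure1E.
Qed.

(* The first two equations are Cauchy-Riemann-like: they say that the derivative
   of f(s) in t, and of f(t) in s, vanishes.  The signs express f' >= 0. *)
Lemma ae_weak_derivatives a b c d : a <= b -> c <= d -> d < a ->
  {ae P, forall p, rect a b c d p ->
    [/\ (Fy p).2 = (Fx p).1, (Fy p).1 = (Fx p).2,
        0 <= (Fx p).1 + (Fx p).2 & 0 <= (Fx p).1 - (Fx p).2]}.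
Proof.
move=> ab cd da; have [L1 L2 L3 L4] := components.
have lmE x y : x <= y -> mu `]x, y] = (y - x)%:E.
  move=> xy; rewrite lebesgue_measure_itv/= lte_fin; case: ltP => //= yx.
  by have -> : x = y; [apply/le_anti; rewrite xy|rewrite subrr].
pose x1 p := (Fx p).1; pose x2 p := (Fx p).2.
pose y1 p := (Fy p).1; pose y2 p := (Fy p).2.
have IC := integral_components.
(* An equality is obtained from two opposite inequalities, each represented by the zero measure. *)
have H1 : {ae P, forall p, rect a b c d p -> 0 <= 1 * x1 p + (- 1) * y2 p}.
  apply: (@ae_ge0_combination x1 y2 _ _ mzero) => // a' b' c' d' h1 h2 h3.
  have [E1 E2 E3 E4] := IC _ _ _ _ h1 h2 h3.
  by rewrite /x1 /y2 E1 E4 /mzero; congr EFin; ring.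
have H2 : {ae P, forall p, rect a b c d p -> 0 <= (- 1) * x1 p + 1 * y2 p}.
  apply: (@ae_ge0_combination x1 y2 _ _ mzero) => // a' b' c' d' h1 h2 h3.
  have [E1 E2 E3 E4] := IC _ _ _ _ h1 h2 h3.
  by rewrite /x1 /y2 E1 E4 /mzero; congr EFin; ring.
have H3 : {ae P, forall p, rect a b c d p -> 0 <= 1 * x2 p + (- 1) * y1 p}.
  apply: (@ae_ge0_combination x2 y1 _ _ mzero) => // a' b' c' d' h1 h2 h3.
  have [E1 E2 E3 E4] := IC _ _ _ _ h1 h2 h3.
  by rewrite /x2 /y1 E2 E3 /mzero; congr EFin; ring.
have H4 : {ae P, forall p, rect a b c d p -> 0 <= (- 1) * x2 p + 1 * y1 p}.
  apply: (@ae_ge0_combination x2 y1 _ _ mzero) => // a' b' c' d' h1 h2 h3.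
  have [E1 E2 E3 E4] := IC _ _ _ _ h1 h2 h3.
  by rewrite /x2 /y1 E2 E3 /mzero; congr EFin; ring.
(* [x1 + x2] stands for f'(s): the Stieltjes measure of [f] acts in s and Lebesgue measure in t. For
   [x1 - x2] below, the roles are exchanged. *)
have H5 : {ae P, forall p, rect a b c d p -> 0 <= 1 * x1 p + 1 * x2 p}.
  have [m mE] := half_product_measure (lebesgue_stieltjes_measure F_cumulative) mu.
  apply: (@ae_ge0_combination x1 x2 _ _ m) => //.
  move=> a' b' c' d' h1 h2 h3; have [E1 E2 E3 E4] := IC _ _ _ _ h1 h2 h3.
  rewrite mE//= lebesgue_stieltjes_measure_itvoc// lmE// -!EFinM.
  by rewrite /x1 /x2 E1 E3; congr EFin; rewrite /=; field.
have H6 : {ae P, forall p, rect a b c d p -> 0 <= 1 * x1 p + (- 1) * x2 p}.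
  have [m mE] := half_product_measure mu (lebesgue_stieltjes_measure F_cumulative).
  apply: (@ae_ge0_combination x1 x2 _ _ m) => //.
  move=> a' b' c' d' h1 h2 h3; have [E1 E2 E3 E4] := IC _ _ _ _ h1 h2 h3.
  rewrite mE//= lebesgue_stieltjes_measure_itvoc// lmE// -!EFinM.
  by rewrite /x1 /x2 E1 E3; congr EFin; rewrite /=; field.
have H12 : {ae P, forall p, rect a b c d p -> y2 p = x1 p}.
  by apply: filterS2 H1 H2 => p h1 h2 Qp; move: (h1 Qp) (h2 Qp); lra.
have H34 : {ae P, forall p, rect a b c d p -> y1 p = x2 p}.
  by apply: filterS2 H3 H4 => p h1 h2 Qp; move: (h1 Qp) (h2 Qp); lra.
have H56 : {ae P, forall p, rect a b c d p -> 0 <= x1 p + x2 p /\ 0 <= x1 p - x2 p}.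
  by apply: filterS2 H5 H6 => p h1 h2 Qp; move: (h1 Qp) (h2 Qp); lra.
by apply: filterS3 H12 H34 H56 => p h1 h2 h3 Qp; have [] := h3 Qp; split=> //;
  [exact: h1|exact: h2].
Qed.

Lemma slope_comparison k : k < 1 ->
  {ae P, forall p, H p ->
    (`|d_zbar (Fx p) (Fy p)| <= k%:C * `|d_z (Fx p) (Fy p)|)%C} ->
  exists2 K, 1 <= K & forall a b c d, a <= b -> c <= d -> d < a ->
    (f b - f a) * (d - c) <= K * ((b - a) * (f d - f c)) /\
    (b - a) * (f d - f c) <= K * ((f b - f a) * (d - c)).
Proof.
(* [k] may be negative, so it is replaced by a bound in [0, 1). Then |f'(s) - f'(t)| <= l (f'(s) +
   f'(t)) bounds the ratio of f'(s) and f'(t) by (1 + l) / (1 - l). *)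
move=> k1 aek; pose l := Num.max 0 k.
have l0 : 0 <= l by rewrite le_max lexx.
have l1 : l < 1 by rewrite gt_max ltr01.
have kl : k <= l by rewrite le_max lexx orbT.
pose K := (1 + l) / (1 - l).
have K1 : 1 <= K by rewrite ler_pdivlMr; lra.
have KE : K * (1 - l) = 1 + l by rewrite divfK//; apply/lt0r_neq0; lra.
exists K => // a b c d ab cd da.
have [L1 L2 L3 L4] := components.
have [E1 _ E3 _] := integral_components ab cd da.
have mQ := measurable_rect a b c d.
have i1 : P.-integrable (rect a b c d) (EFin \o (fun p => (Fx p).1)).
  exact: integrable_rect L1.
have i2 : P.-integrable (rect a b c d) (EFin \o (fun p => (Fx p).2)).
  exact: integrable_rect L3.
have rH : rect a b c d `<=` H.
  by apply: subset_trans (diamond_upper da); exact: rect_diamond.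
have aeb : {ae P, forall p, rect a b c d p ->
    [/\ 0 <= (Fx p).1, (Fx p).2 <= l * (Fx p).1 & - (l * (Fx p).1) <= (Fx p).2]}.
  have aeF : Filter (nbhs (almost_everywhere P)) by exact: ae_filter_ringOfSetsType.
  have aew := ae_weak_derivatives ab cd da.
  apply: filterS2 aek aew => p hk hw Qp.
  have [e1 e2 g0 h0] := hw Qp; have := hk (rH _ Qp).
  have x0 : 0 <= (Fx p).1 by lra.
  have -> : Fx p = ((Fx p).1, (Fx p).2) by case: (Fx p).
  have -> : Fy p = ((Fx p).2, (Fx p).1) by rewrite -e1 -e2; case: (Fy p).
  move=> /cauchy_riemann_dilatation; rewrite /= (ger0_norm x0) => hkx.
  have /ler_normlP[] : `|(Fx p).2| <= l * (Fx p).1.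
    by apply: le_trans hkx _; rewrite ler_wpM2r.
  by move=> *; split=> //; lra.
(* The integrand stands for K f'(t) - f'(s), and the one of [S0] for K f'(s) - f'(t). *)
have R0 : 0 <= \int[P]_(p in rect a b c d) ((K - 1) * (Fx p).1 + (- K - 1) * (Fx p).2).
  apply: Rintegral_ae_ge0 => //; first exact: integrable_linear2.
  apply: filterS aeb => p hp /hp; move: (Fx p).1 (Fx p).2 => p1 p2 [h0 h1 h2].
  (* The definition of [K] gives (K + 1) l = K - 1, so this product is the integrand itself. *)
  have : 0 <= (K + 1) * (l * p1 - p2) by rewrite mulr_ge0//; lra.
  have Kl : K * l = K - 1 - l by lra.
  have -> : (K + 1) * (l * p1 - p2) = (K * l + l) * p1 - (K + 1) * p2 by ring.
  rewrite Kl; lra.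
have S0 : 0 <= \int[P]_(p in rect a b c d) ((K - 1) * (Fx p).1 + (K + 1) * (Fx p).2).
  apply: Rintegral_ae_ge0 => //; first exact: integrable_linear2.
  apply: filterS aeb => p hp /hp; move: (Fx p).1 (Fx p).2 => p1 p2 [h0 h1 h2].
  have : 0 <= (K + 1) * (p2 + l * p1) by rewrite mulr_ge0//; lra.
  have Kl : K * l = K - 1 - l by lra.
  have -> : (K + 1) * (p2 + l * p1) = (K + 1) * p2 + (K * l + l) * p1 by ring.
  rewrite Kl; lra.
rewrite Rintegral_linear2// E1 E3 in R0.
rewrite Rintegral_linear2// E1 E3 in S0.
move: R0 S0; set X := (f b - f a) * (d - c); set Y := (b - a) * (f d - f c).
by move=> R0 S0; split; lra.
Qed.

End WeakFields.

End Comparison.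

(** * From slopes over separated intervals to the bi-Lipschitz bound *)

Theorem mainTheorem3 (R : realType) (f : R -> R)
    (f_homeo : homeomorphism_between [set: R] [set: R] f)
    (f_QC : QC (E_NS f)) :
  bi_lipschitz f.
Proof.
have cf : continuous f.
  by case: f_homeo => g [[_ _ cf] _]; apply/continuous_subspace_setT.
case: f_QC => -[_ [[EH _ _] _]] [Fx [Fy [sobolev [k k1 dil]]]].
(* The chosen point has s = y and t = x, and its image has positive imaginary part; this is what
   excludes decreasing [f]. *)
have f_lt : {homo f : x y / x < y}.
  move=> x y xy.
  have /EH : upper_half_plane ((x + y) / 2, (y - x) / 2).
    by rewrite /upper_half_plane /= divr_gt0// subr_gt0.
  rewrite /upper_half_plane /E_NS /= pmulr_lgt0 ?invr_gt0// subr_gt0.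
  by congr (f _ < f _); field.
have ndf : {homo f : x y / x <= y} by apply: ltW_homo.
have [K K1 cmp] := slope_comparison cf ndf sobolev k1 dil.
have K0 : 0 < K by rewrite (lt_le_trans ltr01).
pose m := f 1 - f 0; have m0 : 0 < m by rewrite subr_gt0 f_lt.
have bounds x y : x <= y ->
    m * (y - x) <= K ^+ 2 * (f y - f x) /\ f y - f x <= K ^+ 2 * m * (y - x).
  (* ]M, M + 1] lies strictly to the right of both ]x, y] and ]0, 1]. Comparing each with it costs a
     factor [K], so the slope over ]x, y] is compared with [m], the slope over ]0, 1], at the cost
     of [K ^+ 2]. *)
  move=> xy; pose M := Num.max 1 y + 1.
  have M1 : 1 < M by rewrite ltr_pwDr// le_max lexx.
  have My : y < M by rewrite ltr_pwDr// le_max lexx orbT.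
  have MM : M <= M + 1 by rewrite lerDl.
  have [h1 h2] := cmp M (M + 1) x y MM xy My.
  have [h3 h4] := cmp M (M + 1) 0 1 MM ler01 M1.
  move: h1 h2 h3 h4; rewrite (addrC M) addrK subr0 mulr1 !mul1r -/m.
  set S := f (1 + M) - f M => h1 h2 h3 h4.
  have yx : 0 <= y - x by rewrite subr_ge0.
  split.
    apply: (@le_trans _ _ (K * (S * (y - x)))).
      by rewrite mulrA ler_wpM2r.
    by rewrite expr2 -mulrA ler_wpM2l// ltW.
  apply: (le_trans h2); rewrite expr2 -!mulrA ler_wpM2l ?(ltW K0)//.
  by rewrite mulrA ler_wpM2r.
(* [K ^+ 2 * m] serves the upper bound, [K ^+ 2 / m] the lower one, and 1 the requirement
   [1 <= c]. *)
pose c := Num.max 1 (Num.max (K ^+ 2 * m) (K ^+ 2 / m)).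
have c1 : 1 <= c by rewrite le_max lexx.
have c0 : 0 < c by rewrite (lt_le_trans ltr01).
have cm : K ^+ 2 * m <= c by rewrite !le_max lexx orbT.
have cm' : K ^+ 2 / m <= c by rewrite !le_max lexx !orbT.
exists c => // x y.
wlog xy : x y / x <= y.
  by move=> W; have [/W//|/ltW/W] := leP x y; rewrite distrC [`|f y - _|]distrC.
have [h1 h2] := bounds _ _ xy.
rewrite !(distrC _ y) !(distrC _ (f y)) !ger0_norm ?subr_ge0 ?ndf//.
have yx : 0 <= y - x by rewrite subr_ge0.
have fyx : 0 <= f y - f x by rewrite subr_ge0 ndf.
apply/andP; split; last by rewrite (le_trans h2)// ler_wpM2r.
rewrite ler_pdivrMl//; apply: le_trans (ler_wpM2r fyx cm').
by rewrite mulrAC ler_pdivlMr// mulrC.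
Qed.
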